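(* Let $k\le n$ be positive integers. Then the number of smooth $k$-gons with $n$ boundary points, counted up to integral equivalence, is bounded above by $4^k\binom{n}{k}\frac{n}{k}$.
   Context: A lattice polygon is a two-dimensional convex hull of finitely many points of a lattice $M\cong\mathbb{Z}^2$ in $M\otimes\mathbb{R}$. It is smooth if at every vertex the primitive generators of its normal cone (equivalently, the primitive edge directions at the vertex) form a lattice basis. A smooth $k$-gon with $n$ boundary points is a smooth lattice polygon with exactly $k$ vertices and exactly $n$ lattice points on its boundary. Two lattice polygons are integrally equivalent if an affine map that maps one lattice bijectively onto the other maps one polygon onto the other. *)

(* Defs.v *)
From mathcomp Require Import all_boot all_order all_algebra.
From mathcomp Require Import all_classical all_reals all_analysis.

Set Implicit Arguments.
Unset Strict Implicit.
Unset Printing Implicit Defensive.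

Import Order.TTheory GRing.Theory Num.Theory.
Import numFieldNormedType.Exports.

Local Open Scope classical_set_scope.
Local Open Scope ring_scope.

(* The lattice is M = Z^2 and M (x) R is 'rV[R]_2 with its usual topology. *)
Section LatticePolygons.
Variable R : realType.
Implicit Types (S P Q : set 'rV[R]_2) (u v x y : 'rV[R]_2).

Definition of_lattice (z : 'rV[int]_2) : 'rV[R]_2 := map_mx intr z.

Definition lattice : set 'rV[R]_2 := range of_lattice.

Definition convex_hull S : set 'rV[R]_2 :=
  [set x | exists (m : nat) (p : 'I_m -> 'rV[R]_2) (w : 'I_m -> R),
     [/\ forall i, S (p i), forall i, 0 <= w i, \sum_(i < m) w i = 1 &
         x = \sum_(i < m) w i *: p i]].

(* P contains three affinely independent points. *)
Definition two_dimensional P : Prop :=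
  exists a b c : 'rV[R]_2,
    [/\ P a, P b, P c & row_free (col_mx (b - a) (c - a))].

Definition lattice_polygon P : Prop :=
  two_dimensional P /\
  exists S, [/\ finite_set S, S `<=` lattice & P = convex_hull S].

(* The vertices are the extreme points. *)
Definition vertices P : set 'rV[R]_2 :=
  [set v | P v /\ forall x y (t : R), P x -> P y -> 0 < t < 1 ->
             v = (1 - t) *: x + t *: y -> x = v /\ y = v].

Definition boundary P : set 'rV[R]_2 := closure P `\` interior P.

Definition pairing u x : R := (u *m x^T) 0 0.

(* Inner normals; the dual lattice is identified with Z^2 by [pairing]. *)
Definition normal_cone P v : set 'rV[R]_2 :=
  [set u | forall x, P x -> pairing u v <= pairing u x].

Definition primitive (z : 'rV[int]_2) : bool := coprimez (z 0 0) (z 0 1).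

Definition lattice_basis (z1 z2 : 'rV[int]_2) : bool :=
  (col_mx z1 z2 : 'M[int]_2) \in unitmx.

Definition cone u1 u2 : set 'rV[R]_2 :=
  [set x | exists a b : R, [/\ 0 <= a, 0 <= b & x = a *: u1 + b *: u2]].

Definition smooth P : Prop :=
  forall v, vertices P v ->
  exists z1 z2 : 'rV[int]_2,
    [/\ primitive z1, primitive z2,
        normal_cone P v = cone (of_lattice z1) (of_lattice z2) &
        lattice_basis z1 z2].

Definition smooth_gons (k n : nat) : set (set 'rV[R]_2) :=
  [set P | [/\ lattice_polygon P, smooth P, (vertices P #= `I_k)%card &
               (boundary P `&` lattice #= `I_n)%card]].

Definition integrally_equivalent P Q : Prop :=
  exists (A : 'M[R]_2) (b : 'rV[R]_2),
    let f := fun x : 'rV[R]_2 => x *m A + b in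
    set_bij lattice lattice f /\ f @` P = Q.

Definition smooth_gon_classes (k n : nat) : set (set (set 'rV[R]_2)) :=
  [set [set Q | integrally_equivalent P Q] | P in smooth_gons k n].

End LatticePolygons.

Arguments smooth_gons R k n : clear implicits.
Arguments smooth_gon_classes R k n : clear implicits.

(* Main.v *)
Require Import Defs.
From mathcomp Require Import all_boot all_order all_algebra.
From mathcomp Require Import all_classical all_reals all_analysis.
From mathcomp Require Import zify ring lra.

(* The inner edge normals of a smooth polygon form a cyclic sequence of integer
   vectors whose consecutive members are bases and whose cones cover the plane
   once. Such a sequence either consists of x, y, -x-y, or contains two opposite
   vectors x and -x (blow down to a Hirzebruch surface). In the second case, with
   y the successor of x, the successor of -x is bx - y for some integer b, and the
   normals between y and -x, and those between bx - y and x, arise by repeatedly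
   inserting the sum of two neighbours, so each is described by a binary tree. A
   polygon with k vertices thus gives one binary tree with k-2 leaves (hence at
   most 4^k possibilities) and a list of k positive edge lengths whose sum is at
   most n (at most C(n,k) possibilities). These data determine the polygon up to
   integral equivalence: the condition that the edges close up is strictly
   monotone in b, so it determines b. Finally n/k >= 1. *)

Set Implicit Arguments.
Unset Strict Implicit.
Unset Printing Implicit Defensive.

Import Order.TTheory GRing.Theory Num.Theory.
Import numFieldNormedType.Exports.

Local Open Scope ring_scope.

(** * Smooth complete fans in the plane *)

Notation ivec := (int * int)%type.

Definition det (x y : ivec) : int := x.1 * y.2 - x.2 * y.1.

Definition lin (x y c : ivec) : ivec :=
  (c.1 * x.1 + c.2 * y.1, c.1 * x.2 + c.2 * y.2).

Lemma det_lin x y c d : det (lin x y c) (lin x y d) = det c d * det x y.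
Proof. by rewrite /det /lin /=; ring. Qed.

Lemma det_lin1r x y c : det x (lin x y c) = c.2 * det x y.
Proof. by rewrite /det /lin /=; ring. Qed.

Lemma det_lin2r x y c : det y (lin x y c) = - (c.1 * det x y).
Proof. by rewrite /det /lin /=; ring. Qed.

Lemma det_lin1l x y c : det (lin x y c) x = - (c.2 * det x y).
Proof. by rewrite /det /lin /=; ring. Qed.

Lemma det_lin2l x y c : det (lin x y c) y = c.1 * det x y.
Proof. by rewrite /det /lin /=; ring. Qed.

Definition detE := (det_lin, det_lin1r, det_lin2r, det_lin1l, det_lin2l).

(** Cramer's rule; it lets any vector be replaced by its integer coordinates in a unimodular
    basis. *)
Lemma lin_det x y u : det x y = 1 -> u = lin x y (det u y, det x u).
Proof.
case: x y u => [x1 x2] [y1 y2] [u1 u2]; rewrite /det /lin /= => h.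
by congr pair; rewrite -[LHS]mulr1 -h; ring.
Qed.

Lemma lin10 x y : lin x y (1, 0) = x.
Proof. by case: x => a b; rewrite /lin /=; congr pair; ring. Qed.

Lemma lin01 x y : lin x y (0, 1) = y.
Proof. by case: y => a b; rewrite /lin /=; congr pair; ring. Qed.

Lemma lin11 x y : lin x y (1, 1) = x + y.
Proof. by rewrite /lin /= !mul1r. Qed.

Lemma linN10 x y : lin x y (-1, 0) = - x.
Proof. by case: x => a b; rewrite /lin /=; congr pair; rewrite /=; ring. Qed.

Lemma linN11 x y : lin x y (-1, -1) = - x - y.
Proof. by case: x y => a b [c d]; rewrite /lin /=; congr pair; rewrite /=; ring. Qed.

Lemma detC x y : det x y = - det y x.
Proof. by rewrite /det; ring. Qed.

Lemma detxx x : det x x = 0.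
Proof. by rewrite /det; ring. Qed.

Lemma detxN x y : det x (- y) = - det x y.
Proof. by rewrite /det /=; ring. Qed.

Lemma detNx x y : det (- x) y = - det x y.
Proof. by rewrite /det /=; ring. Qed.

Lemma lin_comp x y a b c :
  lin (lin x y a) (lin x y b) c = lin x y (lin a b c).
Proof. by rewrite /lin /=; congr pair; ring. Qed.

Lemma linD x y c d : lin x y (c + d) = lin x y c + lin x y d.
Proof. by rewrite /lin; congr pair; rewrite /=; ring. Qed.

(** * Integer inequalities for the fan arguments *)

Lemma mulz_eq1_ge0 (a b : int) : a * b = 1 -> 0 <= b -> b = 1.
Proof.
by case: b => [[|[|b]]|b] //; rewrite ?mulr0 // => h _; have [] := ltP 0 a; nia.
Qed.

(** [(p1, p2)] and [(q1, q2)] are the coordinates of [x] and [y] in a fan cone that contains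
    [x + y]; the implications keep both out of its interior. If [x + y] is interior itself, [p2 > 0]
    would give [x] and [y] the wrong orientation. *)
Lemma split_arith (p1 p2 q1 q2 : int) :
  0 <= p2 + q2 -> 0 <= p1 + q1 -> p1 * q2 - p2 * q1 = 1 ->
  (0 < q2 -> q1 <= 0) -> (0 < p2 -> p1 <= 0) ->
  [\/ p1 + q1 = 1 /\ p2 + q2 = 0, p1 + q1 = 0 /\ p2 + q2 = 1 |
      [/\ p1 = 1, p2 = 0, q1 = 0 & q2 = 1]].
Proof.
move=> du1 du2 d1 h2 h1.
have [e|e] := eqVneq (q2 + p2) 0.
  have e1 : p1 + q1 = 1 by apply: (@mulz_eq1_ge0 q2); nia.
  by apply: Or31; split=> //; rewrite addrC.
have [e'|e'] := eqVneq (q1 + p1) 0.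
  have e1 : p2 + q2 = 1 by apply: (@mulz_eq1_ge0 p1); nia.
  by apply: Or32; split=> //; rewrite addrC.
apply: Or33.
have [/[dup] p20 /h1 p10|p20] : (0 < p2) \/ (p2 <= 0) by lia.
  exfalso; have q20 : q2 <= 0 by lia.
  have : (1 - p1) * (1 - q2) <= q1 * p2 by apply: ler_pM; lia.
  by nia.
have q20 : 1 <= q2 by lia.
have q10 : q1 <= 0 by lia.
have p1e : p1 = 1 by nia.
have q2e : q2 = 1 by nia.
by split=> //; lia.
Qed.

(** [(p, q)] and [(r, s)] are the coordinates, in the basis [x], [z], of the generators of a fan
    cone that contains [- z], and [a = det x y]. The outcomes: the first generator is [- z], the
    second is, or the cone is that of [y] and [x]. *)
Lemma nonpos_arith (p q r s a : int) :
  a < 0 -> 0 <= - p -> 0 <= r -> p * s - q * r = 1 ->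
  (0 < - p -> p * a - q * -1 <= 0) -> (0 < s -> r <= 0) ->
  [\/ p = 0 /\ q = -1, r = 0 /\ s = -1 |
      a = -1 /\ [/\ p = -1, q = -1, r = 1 & s = 0]].
Proof.
move=> a0 p0 r0 d h3 h6.
have [ep|pn0] := eqVneq p 0.
  have e2 : r = 1 by apply: (@mulz_eq1_ge0 (- q)); nia.
  by apply: Or31; split=> //; nia.
have [er|rn0] := eqVneq r 0.
  have e2 : - p = 1 by apply: (@mulz_eq1_ge0 (- s)); nia.
  by apply: Or32; split=> //; nia.
have s0 : s <= 0 by lia.
have qa : q <= - (a * p) by lia.
have b1 : p * s >= 0 by nia.
have b2 : q <= p by nia.
have b3 : r * q >= -1 by lia.
have r1 : r = 1 by nia.
have p1 : p = -1 by nia.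
have q1 : q = -1 by nia.
have s1 : s = 0 by nia.
by apply: Or33; split=> //; nia.
Qed.

Definition normsq (x : ivec) : int := x.1 ^+ 2 + x.2 ^+ 2.

(** Parallelogram law with [x = (p, q)], [z = (r, s)], [y = a z - x]: the squared norm of [x - y] is
    at most [(4 - a ^+ 2) * normsq z]. For [a >= 2] this forces [2 x = a z], against
    [det x z = 1]. *)
Lemma maxnorm_arith (p q r s a : int) : p * s - q * r = 1 -> 0 < a ->
  normsq (p, q) <= normsq (r, s) ->
  normsq (a * r - p, a * s - q) <= normsq (r, s) -> a = 1.
Proof.
rewrite /normsq /= => e a0 h1 h2.
have [a1|a2] : a = 1 \/ 2 <= a by lia.
  by [].
exfalso.
have h3 : (2 * p - a * r) ^+ 2 + (2 * q - a * s) ^+ 2 <= 0.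
  have h4 : 4 * (r ^+ 2 + s ^+ 2) <= a ^+ 2 * (r ^+ 2 + s ^+ 2).
    apply: ler_wpM2r; rewrite ?addr_ge0 ?sqr_ge0 //.
    by move: a2; clear; rewrite expr2; nia.
  have -> : (2 * p - a * r) ^+ 2 + (2 * q - a * s) ^+ 2 =
    2 * (p ^+ 2 + q ^+ 2) + 2 * ((a * r - p) ^+ 2 + (a * s - q) ^+ 2)
    - a ^+ 2 * (r ^+ 2 + s ^+ 2) by ring.
  move: h1 h2 h4; move: (p ^+ 2 + q ^+ 2) (r ^+ 2 + s ^+ 2) => A B.
  by move: (a ^+ 2 * B) (_ ^+ 2 + _ ^+ 2); clear; lia.
have := sqr_ge0 (2 * p - a * r); have := sqr_ge0 (2 * q - a * s) => h4 h5.
have /eqP : (2 * p - a * r) ^+ 2 = 0.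
  by move: h3 h4 h5; move: (_ ^+ 2) (_ ^+ 2); clear; lia.
have /eqP : (2 * q - a * s) ^+ 2 = 0.
  by move: h3 h4 h5; move: (_ ^+ 2) (_ ^+ 2); clear; lia.
rewrite !sqrf_eq0 !subr_eq0 => /eqP e2 /eqP e1.
have : 2 * (p * s - q * r) = 0 by rewrite mulrBr !mulrA e1 e2; ring.
by rewrite e.
Qed.

Lemma seq_argmin (T : eqType) (f : T -> int) (s : seq T) : s != [::] ->
  exists2 v, v \in s & forall w, w \in s -> f v <= f w.
Proof.
elim: s => // a [_ _|b s IH _].
  by exists a; rewrite ?inE // => w; rewrite inE => /eqP->.
have [z zs hz] := IH isT; have [h|h] := leP (f z) (f a).
  exists z; first by rewrite inE zs orbT.
  by move=> w; rewrite inE => /predU1P[->//|/hz].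
exists a; first by rewrite inE eqxx.
by move=> w; rewrite inE => /predU1P[->//|/hz]; apply: le_trans (ltW h).
Qed.

(** * Consecutive rays, blow-downs and opposite pairs *)

Section Fan.
Variable Z : seq ivec.

Definition inside (x y z : ivec) := (0 < det x z) && (0 < det z y).

Definition adj (x y : ivec) :=
  [&& x \in Z, y \in Z, det x y == 1 & ~~ has (inside x y) Z].

Lemma adjP x y :
  reflect [/\ x \in Z, y \in Z, det x y = 1 &
           forall z : ivec, z \in Z -> 0 < det x z -> det z y <= 0] (adj x y).
Proof.
apply: (iffP and4P) => [[-> -> /eqP-> /hasPn h]|[-> -> -> h]]; split=> //.
  by move=> z /h; rewrite /inside negb_and => /orP[] /negP; lia.
by apply/hasPn => z zZ; apply/negP => /andP[/(h z zZ)]; lia.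
Qed.

(** The ray generators of a smooth complete fan; [adj] singles out the maximal cones, oriented
    counterclockwise. *)
Definition fan :=
  [/\ uniq Z, forall z : ivec, z \in Z -> exists y, adj z y,
      forall z : ivec, z \in Z -> exists x, adj x z &
      forall u : ivec, u != 0 -> exists x y, [/\ adj x y, 0 <= det x u & 0 <= det u y]].

(** Two successors differ by a multiple of [x]; unless it is zero, one of them lies strictly between
    [x] and the other. *)
Lemma adj_funr x y y' : adj x y -> adj x y' -> y = y'.
Proof.
move=> /adjP[xZ yZ d1 h] /adjP[_ y'Z d1' h'].
have := h' y yZ; have := h y' y'Z.
rewrite (lin_det y' d1) d1' !detE d1 /=; move: (det y' y) => c h1 h2.
have -> : c = 0 by lia.
by rewrite lin01.
Qed.

Lemma adj_funl x x' y : adj x y -> adj x' y -> x = x'.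
Proof.
move=> /adjP[xZ yZ d1 h] /adjP[x'Z _ d1' h'].
have := h' x xZ; have := h x' x'Z.
rewrite (lin_det x' d1) d1' !detE d1 /=; move: (det x x') => c h1 h2.
have -> : c = 0 by lia.
by rewrite lin10.
Qed.

Hypothesis fanZ : fan.

(** [lin u u (c, 0)] stands for [c u]. The determinant of [z] with its successor is 1 and is
    divisible by [c]. *)
Lemma fan_primitive (z u : ivec) (c : int) :
  z \in Z -> z = lin u u (c, 0) -> c = 1 \/ c = -1.
Proof.
case: fanZ => _ succ _ _ /succ[y /adjP[_ _ d1 _]] ez.
move: d1; rewrite ez /det /lin /= => d1; have : c * det u y = 1.
  by rewrite -d1 /det; ring.
move: (det u y) => d; have [d0|d0|->] := ltgtP d 0; last by rewrite mulr0.
  by right; nia.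
by left; nia.
Qed.

(** Locate [x + y] in a cone of the fan: either it is a generator of that cone, or the cone is that
    of [x] and [y]. *)
Lemma fan_split (x y : ivec) : x \in Z -> y \in Z -> det x y = 1 ->
  adj x y \/ x + y \in Z.
Proof.
move=> xZ yZ d1; case: fanZ => _ _ _ compl.
have u0 : x + y != 0.
  by apply/eqP => e; move: d1; rewrite -[y](addKr x) e addr0 detxN detxx.
have [x' [y' [a' du1 du2]]] := compl _ u0.
have /adjP[x'Z y'Z d1' h] := a'.
have := h x xZ; have := h y yZ; move: u0 du1 du2 d1 (lin_det x d1') (lin_det y d1').
move: (det x y') (det x' x) (det y y') (det x' y) => p1 p2 q1 q2 + + + + ex ey.
rewrite {}ex {}ey in xZ yZ *; rewrite -!linD !detE d1' /det /= !mulr1.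
move=> u0 du1 du2 d1 h2 h1.
case: (split_arith du1 du2 d1 h2 h1) => [[e1 e2]|[e1 e2]|[-> -> -> ->]].
- by right; rewrite [X in lin _ _ X](_ : _ = (1, 0)) ?lin10 //; congr pair.
- by right; rewrite [X in lin _ _ X](_ : _ = (0, 1)) ?lin01 //; congr pair.
- by left; rewrite lin10 lin01.
Qed.

(** The three cones fill the plane and have no ray in their interiors, so [z] is a positive multiple
    of a generator; primitivity finishes. *)
Lemma triangle_cover x y : adj x y -> adj y (- x - y) -> adj (- x - y) x ->
  forall z : ivec, z \in Z -> [\/ z = x, z = y | z = - x - y].
Proof.
move=> /adjP[_ _ d1 h1] /adjP[_ _ _ h2] /adjP[_ _ _ h3] z zZ.
have {h1} := h1 z zZ; have {h2} := h2 z zZ; have {h3} := h3 z zZ.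
have := fan_primitive zZ.
have := lin_det z d1; move: (det z y) (det x z) => a b ez; rewrite {z zZ}ez.
rewrite -linN11 !detE d1 /det /= => prim h3 h2 h1.
have [a0|a0|a0] := ltgtP a 0.
- have eb : b = a by lia.
  have := prim (lin x y (-1,-1)) (-a); rewrite eb.
  case; [by rewrite /lin /=; congr pair; ring| |lia] => ea.
  by rewrite (_ : a = -1); [apply: Or33|lia].
- have b0 : b = 0 by lia.
  have := prim x a; rewrite b0.
  case; [by rewrite /lin /=; congr pair; ring| |lia] => ea.
  by rewrite (_ : a = 1) ?lin10; [apply: Or31|lia].
- have := prim y b; rewrite a0.
  case; [by rewrite /lin /=; congr pair; ring| |lia] => ea.
  by rewrite ea lin01; apply: Or32.
Qed.

Definition opposite_or_triangle :=
  (exists x : ivec, x \in Z /\ - x \in Z) \/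
  (exists x y, [/\ adj x y, adj y (- x - y) & adj (- x - y) x]).

(* Here [x + y = a z] with [a = det x y <= 0]. For [a < 0] the cone from [y] to [x]
   has [- z] as an indecomposable lattice point, unless [a = -1] and that cone
   belongs to the fan. *)
Lemma opposite_nonpos x z y : adj x z -> adj z y -> det x y <= 0 ->
  opposite_or_triangle.
Proof.
move=> axz azy; have /adjP[xZ zZ d1 h1] := axz; have /adjP[_ yZ d2 h2] := azy.
have ey : y = lin x z (-1, det x y) by rewrite {1}(lin_det y d1) (detC y z) d2.
move: ey; move: (det x y) => a ey a0.
have [ea|an0|ea] := ltgtP a 0; [|lia|].
  case: (fanZ) => _ _ _ compl.
have u0 : - z != 0.
  by rewrite oppr_eq0; apply/eqP => e; move: d1; rewrite e /det /= !mulr0 subrr.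
have [x' [y' [a' du1 du2]]] := compl _ u0.
have /adjP[x'Z y'Z d1' h] := a'.
have := h1 x' x'Z; have := h1 y' y'Z; have := h2 x' x'Z; have := h2 y' y'Z.
move: du1 du2 a' x'Z y'Z d1' {h}.
rewrite (lin_det x' d1) (lin_det y' d1) detxN detNx ey !detE d1.
move: (det x' z) (det x x') (det y' z) (det x y') => p q r s.
rewrite /det /= ?mulr1 !opprK mulrN1 opprK => du1 du2 a' x'Z y'Z d1' _ h3 h6 _.
case: (nonpos_arith ea du1 du2 d1' h3 h6) => [[ep eq]|[er es]|[a1 [p1 q1 r1 s1]]].
- left; exists z; split=> //; rewrite -(linN10 z x).
  by rewrite (_ : lin z x _ = lin x z (p, q)) // ep eq /lin /=; congr pair; ring.
- left; exists z; split=> //; rewrite -(linN10 z x).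
  by rewrite (_ : lin z x _ = lin x z (r, s)) // er es /lin /=; congr pair; ring.
- have eyN : - x - z = y by rewrite -linN11 ey a1.
  right; exists x, z; rewrite eyN; split=> //.
  by move: a'; rewrite p1 q1 r1 s1 lin10 linN11 eyN.
by left; exists x; split=> //; rewrite -(linN10 x z) -[X in (_, X)]ea -ey.
Qed.

End Fan.

(* The ray of [z] is the one added by blowing up the cone of [x] and [y]. *)
Lemma blowdown Z x z y : fan Z -> adj Z x z -> adj Z z y -> det x y = 1 ->
  adj (rem z Z) x y /\ fan (rem z Z).
Proof.
move=> fanZ axz azy d1; have [uZ succ pred compl] := fanZ.
have /adjP[xZ zZ dxz h1] := axz; have /adjP[_ yZ dzy h2] := azy.
have ez : z = x + y by rewrite (lin_det z d1) dxz dzy lin11.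
have memr w : w \in rem z Z = (w != z) && (w \in Z) by rewrite mem_rem_uniq.
have xz : x != z by apply/eqP => e; move: dxz; rewrite e detxx.
have yz : y != z by apply/eqP => e; move: dzy; rewrite e detxx.
have axy : adj (rem z Z) x y.
  apply/adjP; rewrite !memr xz yz; split=> // w; rewrite memr => /andP[wz wZ].
  have {h1} := h1 w wZ; have {h2} := h2 w wZ; have := fan_primitive fanZ wZ.
  have := lin_det w d1; move: (det w y) (det x w) => a b ew.
  rewrite {}ew ez -lin11 in wz wZ *.
  rewrite !detE d1 /det /= => prim h2 h1 b0; rewrite leNgt; apply/negP => a0.
  (* [w] lies strictly inside the cone of [x] and [y] but inside neither half cut off by [z], hence
     on the ray of [z]. *)
  have ab : a = b by move: a0 b0 h1 h2; clear; lia.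
  have := prim (lin x y (1, 1)) a; case.
  - by rewrite ab /lin /=; congr pair; ring.
  - by move=> a1; move/negP: wz; apply; rewrite -ab a1.
  - by move: a0; clear; lia.
have sub p q : p != z -> q != z -> adj Z p q -> adj (rem z Z) p q.
  move=> pz qz /adjP[pZ qZ dpq h]; apply/adjP; rewrite !memr pz qz; split=> //.
  by move=> w; rewrite memr => /andP[_ /h].
split=> //; split.
- exact: rem_uniq.
- move=> p; rewrite memr => /andP[pz pZ]; have [q apq] := succ p pZ.
  have [eq|qz] := eqVneq q z; last by exists q; apply: sub.
  by exists y; rewrite eq in apq; rewrite (adj_funl apq axz).
- move=> q; rewrite memr => /andP[qz qZ]; have [p apq] := pred q qZ.
  have [ep|pz] := eqVneq p z; last by exists p; apply: sub.
  by exists x; rewrite ep in apq; rewrite (adj_funr apq azy).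
- move=> u /compl[p [q [apq du1 du2]]].
  have [ep|pz] := eqVneq p z.
    exists x, y; rewrite ep in apq du1; rewrite -(adj_funr apq azy).
    move: du1 du2; rewrite (adj_funr apq azy) => du1 du2; split=> //.
    move: du1 du2; rewrite (lin_det u d1) ez -lin11 !detE d1 /det /=; clear; lia.
  have [eq|qz] := eqVneq q z; last by exists p, q; split=> //; apply: sub.
  exists x, y; rewrite eq in apq du2; rewrite (adj_funl apq axz) in du1.
  split=> //; move: du1 du2.
  by rewrite (lin_det u d1) ez -lin11 !detE d1 /det /=; clear; lia.
Qed.

(* A generator [z] of maximal norm has neighbours with [x + y = a z] and [a <= 1];
   when [a = 1] it can be blown down. *)
Lemma fan_opposite_or_triangle Z : fan Z -> opposite_or_triangle Z.
Proof.
have [m] := ubnP (size Z); elim: m Z => // m IH Z ltm fanZ.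
have [uZ succ pred compl] := fanZ.
have Z0 : Z != [::].
  have [|x [y [/adjP[+ _ _ _] _ _]]] := compl (1, 0); first by [].
  by case: (Z).
have [z zZ zmin] := seq_argmin (fun w => - normsq w) Z0.
have zmax w : w \in Z -> normsq w <= normsq z by move=> /zmin; rewrite lerN2.
have [y azy] := succ z zZ; have [x axz] := pred z zZ.
have /adjP[xZ _ dxz _] := axz; have /adjP[_ yZ dzy _] := azy.
have [a0|a0] := leP (det x y) 0; first exact: (opposite_nonpos fanZ axz azy).
have a1 : det x y = 1.
  have ey : y = lin x z (-1, det x y) by rewrite {1}(lin_det y dxz) (detC y z) dzy.
  have := zmax x xZ; have := zmax y yZ; move: dxz a0 ey.
  move: (det x y) => a + + ey; rewrite ey.
  case: (x) (z) => [p q] [r s]; rewrite /det /lin /= => e a0 h1 h2.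
  apply: (maxnorm_arith e a0 h2); move: h1.
  by rewrite !mulN1r [- p + _]addrC [- q + _]addrC.
have [axy fanZ'] := blowdown fanZ axz azy a1.
have memr w : w \in rem z Z = (w != z) && (w \in Z) by rewrite mem_rem_uniq.
have ltm' : (size (rem z Z) < m)%N by rewrite size_rem //; case: (Z) Z0 ltm.
have ez : z = x + y by rewrite (lin_det z a1) dxz dzy lin11.
case: (IH _ ltm' fanZ') => [[w []]|[p [q [apq aqr arp]]]].
  by rewrite !memr => /andP[_ wZ] /andP[_ w'Z]; left; exists w.
(* The blown-down fan is a triangle having the cone of [x] and [y], so its third ray is
   [- x - y = - z]. *)
have cov := triangle_cover fanZ' apq aqr arp.
left; exists z; split=> //; rewrite ez opprD.
have /adjP[pZ' qZ' _ _] := apq; have /adjP[_ rZ' _ _] := aqr.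
suff : - x - y \in rem z Z by rewrite memr => /andP[].
have /adjP[xZ' yZ' _ _] := axy.
case: (cov x xZ') => ex; rewrite ex in axy *.
- by rewrite -(adj_funr apq axy).
- by rewrite -(adj_funr aqr axy) opprB addKr opprK.
- by rewrite -(adj_funr arp axy) opprB opprK addrK.
Qed.

(** * Subdivisions described by binary trees *)

Inductive tree := Leaf | Node of tree & tree.

Fixpoint leaves t := if t is Node t1 t2 then (leaves t1 + leaves t2)%N else 1%N.

(* The rays after [x], up to and including [y], of the subdivision of the cone
   spanned by [x] and [y] in which [Node] inserts the ray through [x + y]. *)
Fixpoint rays t (x y : ivec) : seq ivec :=
  if t is Node t1 t2 then rays t1 x (x + y) ++ rays t2 (x + y) y else [:: y].

Lemma size_rays t x y : size (rays t x y) = leaves t.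
Proof. by elim: t x y => //= t1 IH1 t2 IH2 x y; rewrite size_cat IH1 IH2. Qed.

Lemma last_rays t x y w : last w (rays t x y) = y.
Proof. by elim: t x y w => //= t1 _ t2 IH2 x y w; rewrite last_cat IH2. Qed.

Lemma map_lin_rays t x y u v :
  map (lin x y) (rays t u v) = rays t (lin x y u) (lin x y v).
Proof.
by elim: t u v => //= t1 IH1 t2 IH2 u v; rewrite map_cat IH1 IH2 linD.
Qed.

Lemma rays_cone t x y z : z \in rays t x y ->
  exists a b, [/\ 0 <= a, 1 <= b & z = lin x y (a, b)].
Proof.
elim: t x y => [|t1 IH1 t2 IH2] x y /=.
  by rewrite inE => /eqP->; exists 0, 1; rewrite lin01.
rewrite mem_cat => /orP[/IH1|/IH2] [a [b [a0 b1 ->]]].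
  exists (a + b), b; split=> //; first by move: a0 b1; clear; lia.
  by rewrite /lin /=; congr pair; ring.
exists a, (a + b); split=> //; first by move: a0 b1; clear; lia.
by rewrite /lin /=; congr pair; ring.
Qed.

(** The ray of [x + y] separates the two halves: [det (x + y)] is nonpositive on the first and
    positive on the second. *)
Lemma uniq_rays t x y : det x y = 1 -> uniq (rays t x y).
Proof.
elim: t x y => [|t1 IH1 t2 IH2] x y d1 //=.
have dl : det x (x + y) = 1 by rewrite -lin11 !detE d1.
have dr : det (x + y) y = 1 by rewrite -lin11 !detE d1.
rewrite cat_uniq IH1 // IH2 // andbT /=; apply/hasPn => z.
move=> /rays_cone[a [b [a0 b1 ez]]]; apply/negP => /rays_cone[c [d [c0 d1' ez']]].
have := congr1 (det (x + y)) ez; rewrite {1}ez' !detE dl dr /=.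
by move: b1 c0; clear; lia.
Qed.

Section FanTree.
Variable Z : seq ivec.
Hypothesis fanZ : fan Z.

(** Induction on the number of rays strictly inside the cone: [x + y] is one of them and is inside
    neither half. *)
Lemma fan_tree x y : x \in Z -> y \in Z -> det x y = 1 ->
  exists t, path (adj Z) x (rays t x y).
Proof.
have [m] := ubnP (count (inside x y) Z); elim: m x y => // m IH x y ltm xZ yZ d1.
have [axy|xyZ] := fan_split fanZ xZ yZ d1; first by exists Leaf; rewrite /= axy.
have dl : det x (x + y) = 1 by rewrite -lin11 !detE d1.
have dr : det (x + y) y = 1 by rewrite -lin11 !detE d1.
have sub (p : pred ivec) : subpred p (inside x y) -> ~~ p (x + y) ->
    (count p Z < count (inside x y) Z)%N.
  move=> ps np; elim: (Z) xyZ => // w s IHs; rewrite inE => /predU1P[<-|/IHs h] /=.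
    rewrite (negPf np) /inside dl dr /= add0n add1n ltnS; exact: sub_count.
  have pw : (p w <= inside x y w)%N by case: (p w) (@ps w) => // ->.
  by rewrite -addnS leq_add.
have [|t1 h1] := IH x (x + y) _ xZ xyZ dl.
  apply: leq_trans (sub _ _ _) _ => //; last by rewrite /inside detxx andbF.
  move=> w; rewrite /inside (lin_det w d1) -lin11 !detE d1 /det /=; clear; lia.
have [|t2 h2] := IH (x + y) y _ xyZ yZ dr.
  apply: leq_trans (sub _ _ _) _ => //; last by rewrite /inside detxx.
  move=> w; rewrite /inside (lin_det w d1) -lin11 !detE d1 /det /=; clear; lia.
by exists (Node t1 t2); rewrite /= cat_path h1 last_rays h2.
Qed.

Lemma fan_on_ray x y (c : int) z : 0 <= c -> z \in Z -> z = lin x y (c, 0) ->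
  z = x.
Proof.
move=> c0 zZ ez; have := fan_primitive fanZ zZ (u := x) (c := c).
case=> [|e|e]; last by move: e c0; clear; lia.
  by rewrite ez /lin /= !mul0r.
by rewrite ez e lin10.
Qed.

Lemma rays_cover t x y z : det x y = 1 -> path (adj Z) x (rays t x y) ->
  z \in Z -> 0 <= det x z -> 0 <= det z y -> z \in x :: rays t x y.
Proof.
move=> + + zZ; elim: t x y => [|t1 IH1 t2 IH2] x y d1 /=.
  rewrite andbT => /adjP[_ _ _ /(_ z zZ)]; have := lin_det z d1.
  move: (det z y) (det x z) => a b ez h b0 a0.
  rewrite !inE; have [eb|bn] := eqVneq b 0.
    by rewrite (@fan_on_ray x y _ _ a0 zZ) ?eqxx // ez eb.
  have ea : a = 0 by move: h b0 a0 bn; clear; lia.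
  rewrite (@fan_on_ray y (- x) _ _ b0 zZ) ?eqxx ?orbT //.
  by rewrite ez ea /lin /=; congr pair; ring.
rewrite cat_path last_rays => /andP[h1 h2] xz zy.
have dl : det x (x + y) = 1 by rewrite -lin11 !detE d1.
have dr : det (x + y) y = 1 by rewrite -lin11 !detE d1.
have [le0|gt0] := leP 0 (det z (x + y)).
  by have := IH1 _ _ dl h1 xz le0; rewrite !inE mem_cat => /orP[->|->]; rewrite ?orbT.
have := IH2 _ _ dr h2 _ zy; rewrite (detC (x + y)) oppr_ge0 (ltW gt0) => /(_ isT).
rewrite !inE mem_cat => /predU1P[->|->]; last by rewrite !orbT.
move: (mem_last x (rays t1 x (x + y))); rewrite last_rays inE.
by case/orP=> ->; rewrite ?orbT.
Qed.

(** [Leaf] stands for the fan of the projective plane. The root of a [Node] is no subdivision but a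
    pair: its subtrees subdivide two opposite cones of the Hirzebruch fan with parameter [b], the
    other two being cones of the fan already. Both cases give [leaves t + 2] rays. *)
Definition circuit t (x y : ivec) (b : int) : seq ivec :=
  if t is Node t1 t2 then
    let y' := lin x y (b, -1) in y :: rays t1 y (- x) ++ y' :: rays t2 y' x
  else [:: y; - x - y; x].

Lemma size_circuit t x y b : size (circuit t x y b) = (leaves t + 2)%N.
Proof.
by case: t => //= t1 t2; rewrite size_cat /= !size_rays addnS addn2.
Qed.

Lemma last_circuit t x y b w : last w (circuit t x y b) = x.
Proof. by case: t => //= t1 t2; rewrite last_cat /= last_rays. Qed.

(** Brings circuits to the standard basis, where those of different polygons can be compared. *)
Lemma circuit_lin t x y b :
  circuit t x y b = map (lin x y) (circuit t (1, 0) (0, 1) b).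
Proof.
have eN : lin x y (- 1, - 0) = - x by rewrite oppr0 linN10.
case: t => [|t1 t2] /=.
  by rewrite lin01 lin10 (_ : - (1, 0) - (0, 1) = (-1, -1)) ?linN11.
rewrite map_cat /= !map_lin_rays lin01 lin10 -lin_comp lin10 lin01.
by rewrite (_ : - (1, 0) = (- 1, - 0)) // eN.
Qed.

Lemma path_adj_sub x s : path (adj Z) x s -> {subset s <= Z}.
Proof.
elim: s x => //= a s IH x /andP[/adjP[_ aZ _ _] /IH h] w.
by rewrite inE => /predU1P[->//|/h].
Qed.

Lemma uniq_cons_rays t x y : det x y = 1 -> uniq (x :: rays t x y).
Proof.
move=> d1; rewrite /= uniq_rays // andbT; apply/negP => /rays_cone[a [b [_ b1 ex]]].
have := congr1 (det x) ex; rewrite detxx detE d1 /=.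
by move: b1; clear; lia.
Qed.

Lemma cons_rays_cone t x y z : z \in x :: rays t x y ->
  exists a b, [/\ 0 <= a, 0 <= b, 1 <= a + b & z = lin x y (a, b)].
Proof.
rewrite inE => /predU1P[->|/rays_cone[a [b [a0 b1 ->]]]].
  by exists 1, 0; rewrite lin10.
by exists a, b; split=> //; move: a0 b1; clear; lia.
Qed.

(** For [Node], the two blocks lie on opposite closed sides of the line through [x]; on that line
    the first has only negative multiples of [x], the second only positive ones. *)
Lemma uniq_circuit t x y b : det x y = 1 -> uniq (circuit t x y b).
Proof.
move=> d1; case: t => [|t1 t2].
  rewrite -[circuit _ _ _ _]/[:: y; - x - y; x] /= !inE negb_or !andbT.
  apply/andP; split; first apply/andP; try split;
  by apply/eqP => /(congr1 (det x)); rewrite -?linN11 ?detE ?detxx d1.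
have d2 : det y (- x) = 1 by rewrite detxN (detC y) opprK.
set y' := lin x y (b, -1).
have d3 : det y' x = 1 by rewrite detE d1.
rewrite -[circuit _ _ _ _]/((y :: rays t1 y (- x)) ++ (y' :: rays t2 y' x)).
rewrite cat_uniq !uniq_cons_rays // andbT andTb; apply/hasPn => z.
move=> /cons_rays_cone[c [d [c0 d0 cd ez]]].
apply/negP => /cons_rays_cone[p [q [p0 q0 pq ez']]].
have := congr1 (det x) ez; have := congr1 (det^~ y) ez.
have e1 : det x (lin y' x (c, d)) = - (c * det x y).
  by rewrite /y' /det /lin /=; ring.
have e2 : det (lin y' x (c, d)) y = (b * c + d) * det x y.
  by rewrite /y' /det /lin /=; ring.
have e3 : det x (lin y (- x) (p, q)) = p * det x y.
  by rewrite /det /lin /=; ring.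
have e4 : det (lin y (- x) (p, q)) y = - (q * det x y).
  by rewrite /det /lin /=; ring.
rewrite /= {1 2}ez' {}e1 {}e2 {}e3 {}e4 d1 !mulr1 => h1 h2.
have ec : c = 0 by move: c0 p0 h2; clear; lia.
move: h1 h2; rewrite ec mulr0 add0r => h1 h2.
by move: cd pq d0 q0 h1 h2; rewrite ec; clear; lia.
Qed.

Theorem fan_circuit : exists t x y b,
  [/\ x \in Z, det x y = 1, path (adj Z) x (circuit t x y b) &
      perm_eq (circuit t x y b) Z].
Proof.
have [uZ succ pred compl] := fanZ.
have [[x [xZ nxZ]]|[x [y [axy ayr arx]]]] := fan_opposite_or_triangle fanZ; last first.
  have /adjP[xZ yZ dxy _] := axy; have /adjP[_ rZ _ _] := ayr.
  have pth : path (adj Z) x (circuit Leaf x y 0) by rewrite /= axy ayr arx.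
  exists Leaf, x, y, 0; split=> //; apply: uniq_perm => //.
    exact: uniq_circuit.
  move=> z; apply/idP/idP; first exact: path_adj_sub pth z.
  move=> /(triangle_cover fanZ axy ayr arx) h; rewrite !inE.
  by case: h => ->; rewrite eqxx ?orbT.
have [y axy] := succ x xZ; have [y' axy'] := succ _ nxZ.
have /adjP[_ yZ dxy h1] := axy; have /adjP[_ y'Z dxy' h2] := axy'.
have d2 : det y (- x) = 1 by rewrite detxN (detC y) opprK.
have d3 : det y' x = 1 by rewrite detC -detNx.
have [t1 p1] := fan_tree yZ nxZ d2; have [t2 p2] := fan_tree y'Z xZ d3.
(* [det (- x) y' = 1] fixes the coefficient of [y]; the remaining coefficient is the Hirzebruch
   parameter. *)
have ey' : y' = lin x y (det y' y, -1).
  by rewrite {1}(lin_det y' dxy) (detC x y') d3.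
have pth : path (adj Z) x (circuit (Node t1 t2) x y (det y' y)).
  by rewrite /= -ey' cat_path last_rays axy p1 /= axy' p2.
exists (Node t1 t2), x, y, (det y' y); split=> //; apply: uniq_perm => //.
  exact: uniq_circuit.
move=> z; apply/idP/idP; first exact: path_adj_sub pth z.
move=> zZ; rewrite -[circuit _ _ _ _]/((y :: rays t1 y (- x)) ++
  (lin x y (det y' y, -1) :: rays t2 (lin x y (det y' y, -1)) x)) -ey' mem_cat.
(* No ray is strictly between [x] and [y] or between [- x] and [y']. So a ray on one side of the
   line through [x] is in the cone of [y] and [- x], on the other side in that of [y'] and [x], and
   on the line it is [x] or [- x]. *)
have [gt0|lt0|eq0] := ltgtP 0 (det x z).
- rewrite (rays_cover d2 p1) ?detxN //.
    by rewrite detC oppr_ge0; apply: h1.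
  by rewrite (detC z) opprK ltW.
- apply/orP; right; rewrite (rays_cover d3 p2) //.
    by rewrite detC oppr_ge0; apply: h2 => //; rewrite detNx oppr_gt0.
  by rewrite (detC z) oppr_ge0 ltW.
- have ez : z = lin x y (det z y, 0) by rewrite {1}(lin_det z dxy) -eq0.
  have [ge0|lt0] := leP 0 (det z y).
    rewrite (fan_on_ray ge0 zZ ez).
    by rewrite -[X in X \in y' :: _](last_rays t2 y' x y') mem_last orbT.
  have le0 : 0 <= - det z y by rewrite oppr_ge0 ltW.
  rewrite (@fan_on_ray (- x) (- y) _ _ le0 zZ).
    by rewrite -[X in X \in y :: _](last_rays t1 y (- x) y) mem_last.
  by rewrite {1}ez /lin /=; congr pair; ring.
Qed.

End FanTree.

(** * Lattice polygons with unimodular corners *)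

Definition dot (u x : ivec) : int := u.1 * x.1 + u.2 * x.2.

(* The lattice point [l] units along the edge that leaves [v] counterclockwise
   and has inner normal [z]. *)
Definition step (v z : ivec) (l : nat) : ivec :=
  (v.1 + l%:Z * z.2, v.2 - l%:Z * z.1).

Lemma dot_step u v z l : dot u (step v z l) = dot u v + l%:Z * det u z.
Proof. by rewrite /dot /step /det /=; ring. Qed.

Lemma step0 v z : step v z 0 = v.
Proof. by case: v => a b; rewrite /step /=; congr pair; ring. Qed.

Lemma dot_lin u v c x : dot (lin u v c) x = c.1 * dot u x + c.2 * dot v x.
Proof. by rewrite /dot /lin /=; ring. Qed.

Lemma dot_inj x y v w : det x y = 1 -> dot x v = dot x w -> dot y v = dot y w ->
  v = w.
Proof.
case: x y v w => [x1 x2] [y1 y2] [v1 v2] [w1 w2]; rewrite /det /dot /= => d ex ey.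
have e1 : v1 = w1.
  apply/eqP; rewrite -subr_eq0 -[_ - _]mulr1 -d; apply/eqP.
  transitivity ((x1 * v1 + x2 * v2 - (x1 * w1 + x2 * w2)) * y2 -
    (y1 * v1 + y2 * v2 - (y1 * w1 + y2 * w2)) * x2); first by ring.
  by rewrite ex ey !subrr !mul0r subrr.
rewrite e1; congr pair.
apply/eqP; rewrite -subr_eq0 -[_ - _]mulr1 -d; apply/eqP.
transitivity ((y1 * v1 + y2 * v2 - (y1 * w1 + y2 * w2)) * x1 -
  (x1 * v1 + x2 * v2 - (x1 * w1 + x2 * w2)) * y1); first by ring.
by rewrite ex ey !subrr !mul0r subrr.
Qed.

Lemma seq_bound (T : eqType) (f : T -> int) (s : seq T) :
  exists M, forall w, w \in s -> f w <= M.
Proof.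
elim: s => [|a s [M hM]]; first by exists 0.
exists (Num.max (f a) M) => w; rewrite inE le_max => /predU1P[->|/hM->].
  by rewrite lexx.
by rewrite orbT.
Qed.

Definition minimized (W : seq ivec) (u v : ivec) :=
  forall w, w \in W -> dot u v <= dot u w.

(* [x] and [y] generate the cone of inner normals of [W] at [v]. *)
Definition corner (W : seq ivec) (v x y : ivec) :=
  [/\ det x y = 1, minimized W x v, minimized W y v &
      forall u, minimized W u v -> 0 <= det u y /\ 0 <= det x u].

Section Polygon.
Variables (W : seq ivec) (z1 z2 : ivec -> ivec).
Hypothesis uniqW : uniq W.
Hypothesis W0 : W != [::].
Hypothesis cornerW : forall v, v \in W -> corner W v (z1 v) (z2 v).

Lemma corner_det v : v \in W -> det (z1 v) (z2 v) = 1.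
Proof. by case/cornerW. Qed.

(** At every other point of [W] the strictly minimized [y] grows by at least 1, so [M y - x] is
    minimized once [M] bounds the growth of [x]. *)
Lemma minimized_tilt x y v : minimized W x v ->
  (forall w, w \in W -> w != v -> dot y v < dot y w) ->
  exists M, minimized W (lin y x (M, -1)) v.
Proof.
move=> hx hy; have [M hM] := seq_bound (fun w => dot x w - dot x v) W.
exists M => w wW; rewrite !dot_lin /=.
have [->|wv] := eqVneq w v; first exact: lexx.
have /= h1 := hM w wW; have h2 := hy w wW wv; have h3 := hx w wW.
have : M * 1 <= M * (dot y w - dot y v).
  by apply: ler_wpM2l; move: h1 h2 h3; clear; lia.
by move: h1; rewrite mulrBr; move: (M * dot y w) (M * dot y v); clear; lia.
Qed.

(** Otherwise [z2 v] is minimized only at [v], and tilting it away from [z1 v] gives an inner normal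
    outside the cone. *)
Lemma edge_exists v : v \in W ->
  exists w, [/\ w \in W, w != v & dot (z2 v) w = dot (z2 v) v].
Proof.
move=> vW; have [d1 m1 m2 hN] := cornerW vW.
have [/hasP[w wW /andP[wv /eqP e]]|/hasPn h] :=
  boolP (has (fun w => (w != v) && (dot (z2 v) w == dot (z2 v) v)) W).
  by exists w.
have [w wW wv|M hM] := minimized_tilt m1 (y := z2 v).
  by rewrite lt_neqAle m2 // andbT eq_sym; have := h w wW; rewrite wv.
by have [] := hN _ hM; rewrite detE (detC (z2 v)) d1.
Qed.

(** As [z2 v] is also an inner normal at [w], [det (z1 w) (z2 v)] is nonnegative; comparing [z1 w]
    at [v] and [w] makes it nonpositive. So the two are parallel, and [det (z1 v) (z2 v) = 1] makes
    them equal. *)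
Lemma edge_shape v w : v \in W -> w \in W -> w != v ->
  dot (z2 v) w = dot (z2 v) v ->
  z1 w = z2 v /\ exists2 l, (0 < l)%N & w = step v (z2 v) l.
Proof.
move=> vW wW wv ew.
have [d1 m1 m2 _] := cornerW vW; have [d2 m3 m4 hN] := cornerW wW.
have ow : w = step v (z2 v) `|dot (z1 v) w - dot (z1 v) v|%N.
  apply: (dot_inj d1); rewrite dot_step ?detxx ?mulr0 ?addr0 // d1 mulr1.
  by rewrite gez0_abs ?subr_ge0 ?m1 // [RHS]addrC subrK.
have l0 : (0 < `|dot (z1 v) w - dot (z1 v) v|)%N.
  rewrite lt0n; apply: contraNneq wv => e.
  by rewrite ow e step0.
move: ow l0; move: `|_|%N => l ow l0.
have [|h1 h2] := hN (z2 v); first by move=> u uW; rewrite ew m2.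
have q0 : det (z1 w) (z2 v) = 0.
  have := m3 v vW; rewrite {2}ow dot_step; move: h2 l0.
  by move: (det _ _) (dot _ _); clear; nia.
have ez : z2 v = lin (z1 w) (z2 w) (det (z2 v) (z2 w), 0).
  by rewrite {1}(lin_det (z2 v) d2) q0.
split; last by exists l.
have e1 : det (z2 v) (z2 w) = 1.
  apply: (@mulz_eq1_ge0 (det (z1 v) (z1 w))) => //.
  by rewrite -d1 [in RHS]ez /det /lin /=; ring.
by rewrite ez e1 lin10.
Qed.

(** [z2 v] and [z2 v'] agree modulo [z1 v], so along the edge with that normal they are minimized at
    the same point. *)
Lemma z1_inj : {in W &, injective z1}.
Proof.
move=> v v' vW v'W e.
have [d1 m1 m2 _] := cornerW vW; have [d2 m3 m4 _] := cornerW v'W.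
rewrite -{}e in d2 m3.
have ex : dot (z1 v) v = dot (z1 v) v' by apply/le_anti; rewrite m1 // m3.
apply: (dot_inj d1 ex); apply/le_anti; rewrite m2 //=.
have := m4 v vW; rewrite (lin_det (z2 v') d1) d2 !dot_lin /= ex !mul1r.
by rewrite lerD2l.
Qed.

Lemma z2_inj : {in W &, injective z2}.
Proof.
move=> v v' vW v'W e.
have [d1 m1 m2 _] := cornerW vW; have [d2 m3 m4 _] := cornerW v'W.
rewrite -{}e in d2 m4.
have ey : dot (z2 v) v = dot (z2 v) v' by apply/le_anti; rewrite m2 // m4.
apply: (dot_inj d1 _ ey); apply/le_anti; rewrite m1 //=.
have := m3 v vW; rewrite (lin_det (z1 v') d1) d2 !dot_lin /= ey !mul1r.
by rewrite lerD2r.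
Qed.

(** * The fan of edge normals *)

Definition normals := map z1 W.

Lemma uniq_normals : uniq normals.
Proof. by rewrite map_inj_in_uniq //; exact: z1_inj. Qed.

(** [z2] injects [W] into [normals], which has the same size. *)
Lemma normals_z2 : map z2 W =i normals.
Proof.
have sub : {subset map z2 W <= normals}.
  move=> _ /mapP[v vW ->]; have [w [wW wv ew]] := edge_exists vW.
  by have [<- _] := edge_shape vW wW wv ew; apply: map_f.
have uz2 : uniq (map z2 W) by rewrite map_inj_in_uniq //; exact: z2_inj.
by have [|_ h] := uniq_min_size uz2 sub; rewrite ?size_map.
Qed.

(** A normal strictly between [z1 v] and [z2 v] would be minimized at [v] alone, but it belongs to
    an edge with two vertices. *)
Lemma adj_normals v : v \in W -> adj normals (z1 v) (z2 v).
Proof.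
move=> vW; have [d1 m1 m2 _] := cornerW vW; apply/adjP; split=> //.
- exact: map_f.
- by rewrite -normals_z2 map_f.
move=> z; rewrite -normals_z2 => /mapP[v' v'W ->{z}] b0.
have [_ _ m3 _] := cornerW v'W; have [w [wW wv ew]] := edge_exists v'W.
rewrite leNgt; apply/negP => a0.
have eqv u : u \in W -> dot (z2 v') u = dot (z2 v') v' -> u = v.
  move=> uW eu; have := m3 v vW; rewrite -{}eu (lin_det (z2 v') d1) !dot_lin /=.
  have := m1 u uW; have := m2 u uW; move: a0 b0.
  move: (det (z2 v') (z2 v)) (det (z1 v) (z2 v')) => a b a0 b0 h2 h1 h3.
  have h4 : 0 <= a * (dot (z1 v) u - dot (z1 v) v).
    by apply: mulr_ge0; [exact: ltW | rewrite subr_ge0].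
  have h5 : 0 <= b * (dot (z2 v) u - dot (z2 v) v).
    by apply: mulr_ge0; [exact: ltW | rewrite subr_ge0].
  rewrite !mulrBr in h4 h5.
  have e1 : a * dot (z1 v) u = a * dot (z1 v) v by move: h3 h4 h5; clear; lia.
  have e2 : b * dot (z2 v) u = b * dot (z2 v) v by move: h3 h4 h5; clear; lia.
  apply: (dot_inj d1); first by move/(mulfI (lt0r_neq0 a0)): e1.
  by move/(mulfI (lt0r_neq0 b0)): e2.
by move: wv; rewrite (eqv w wW ew) (eqv v' v'W) ?eqxx.
Qed.

(** For completeness, [u] lies in the normal cone at a vertex where it is minimal. *)
Lemma fan_normals : fan normals.
Proof.
split.
- exact: uniq_normals.
- by move=> _ /mapP[v vW ->]; exists (z2 v); apply: adj_normals.
- move=> z; rewrite -normals_z2 => /mapP[v vW ->]; exists (z1 v).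
  exact: adj_normals.
- move=> u _; have [v vW hv] := seq_argmin (dot u) W0.
  have [_ _ _ /(_ u hv)[h1 h2]] := cornerW vW.
  by exists (z1 v), (z2 v); split=> //; apply: adj_normals.
Qed.

(* The edge with inner normal [z] runs from [v] to [w]. *)
Definition edge_length (z : ivec) : nat :=
  let v := nth 0 W (index z (map z2 W)) in
  let w := nth 0 W (index z (map z1 W)) in
  `|dot (z1 v) w - dot (z1 v) v|%N.

Lemma edge_lengthP v : v \in W ->
  [/\ (0 < edge_length (z2 v))%N, step v (z2 v) (edge_length (z2 v)) \in W &
      z1 (step v (z2 v) (edge_length (z2 v))) = z2 v].
Proof.
move=> vW; have [w [wW wv ew]] := edge_exists vW.
have [ez [l l0 ow]] := edge_shape vW wW wv ew.
suff -> : edge_length (z2 v) = l by rewrite -ow.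
rewrite /edge_length (nth_index_map _ z2_inj) // -ez (nth_index_map _ z1_inj) //.
by rewrite ow dot_step corner_det // mulr1 addrC addKr.
Qed.

Fixpoint walk (v : ivec) (ls : seq nat) (s : seq ivec) : seq ivec :=
  match ls, s with
  | l :: ls', z :: s' => let v' := step v z l in v' :: walk v' ls' s'
  | _, _ => [::]
  end.

Lemma walk_normals v s : v \in W -> path (adj normals) (z1 v) s ->
  {subset walk v (map edge_length s) s <= W} /\
  map z1 (walk v (map edge_length s) s) = s.
Proof.
elim: s v => [|z s IH] v vW //= /andP[az].
have <- := adj_funr (adj_normals vW) az.
have [_ wW ez] := edge_lengthP vW.
rewrite -{1}ez => /(IH _ wW)[h1 h2]; split; last by rewrite h2 ez.
by move=> u; rewrite inE => /predU1P[->//|/h1].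
Qed.

(** The normals met on the walk are distinct and exhaust [normals], so each vertex is visited once.
    The last one is [x = z1 v], so the walk ends at [v] by injectivity of [z1]. *)
Theorem polygon_walk : exists t x y b v ls,
  let s := circuit t x y b in
  [/\ det x y = 1, ls = map edge_length s, perm_eq s normals,
      perm_eq (walk v ls s) W & last v (walk v ls s) = v].
Proof.
have [t [x [y [b [xZ dxy pth per]]]]] := fan_circuit fan_normals.
case/mapP: xZ => v vW ex; exists t, x, y, b, v, (map edge_length (circuit t x y b)).
set s := circuit t x y b in pth per *.
rewrite ex in pth; have [sub e] := walk_normals vW pth.
have uw : uniq (walk v (map edge_length s) s).
  by apply: (@map_uniq _ _ z1); rewrite e (perm_uniq per) uniq_normals.
have [|_ ew] := uniq_min_size uw sub.
  by rewrite -(size_map z1 (walk _ _ _)) e (perm_size per) size_map.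
split=> //; first exact: uniq_perm.
have lastW : last v (walk v (map edge_length s) s) \in W.
  have := mem_last v (walk v (map edge_length s) s).
  by rewrite inE => /predU1P[->//|/sub].
by apply: z1_inj => //; rewrite -last_map e last_circuit.
Qed.

(** Half-open edges: each vertex is counted once, and the total is the sum of the edge lengths. *)
Definition edge_points : seq ivec :=
  [seq step v (z2 v) j | v <- W, j <- iota 0 (edge_length (z2 v))].

Lemma size_edge_points :
  size edge_points = sumn (map edge_length (map z2 W)).
Proof.
rewrite size_allpairs_dep -map_comp; congr sumn; apply: eq_map => v /=.
by rewrite size_iota.
Qed.

(** Along the edge of [v'] the pairing with [z2 v] is affine and at least its value at [v]; reaching
    that value before the last endpoint, it already has it at [v']. *)
Lemma edge_meet (v v' : ivec) j j' : v \in W -> v' \in W ->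
  (j' < edge_length (z2 v'))%N ->
  step v (z2 v) j = step v' (z2 v') j' -> v' = v \/ z1 v' = z2 v.
Proof.
move=> vW v'W jl' e; have [_ _ m _] := cornerW vW.
have [l0 wW _] := edge_lengthP v'W.
have [ev|ev] := eqVneq v' v; [by left|right].
suff h : dot (z2 v) v' = dot (z2 v) v by have [] := edge_shape vW v'W ev h.
have := congr1 (dot (z2 v)) e; rewrite !dot_step detxx mulr0 addr0.
have := m _ wW; have := m _ v'W; rewrite dot_step.
move: (dot (z2 v) v) (dot (z2 v) v') (det _ _) (edge_length _) jl' => p q c l jl h1 h2 h3.
rewrite {}h3 in h1 h2 *.
have c0 : j'%:Z * c <= 0 by move: h1; clear; lia.
have c1 : 0 <= (l%:Z - j'%:Z) * c by rewrite mulrBl; move: h2; clear; lia.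
suff -> : j'%:Z * c = 0 by rewrite addr0.
by move: c0 c1 jl; clear; nia.
Qed.

Lemma uniq_edge_points : uniq edge_points.
Proof.
apply: allpairs_uniq_dep => //; first by move=> v _; exact: iota_uniq.
move=> _ _ /allpairsPdep[v [j [vW + ->]]] /allpairsPdep[v' [j' [v'W + ->]]] /=.
rewrite !mem_iota !add0n /= => jl jl' e.
have ev : v' = v.
  case: (edge_meet vW v'W jl' e) => // h1.
  case: (edge_meet v'W vW jl (esym e)) => // h2.
  (* Two edges cannot each follow the other: [det] would change sign. *)
  by have := corner_det vW; rewrite -h1 h2 detC corner_det.
rewrite ev in e *; congr Tagged.
have := congr1 (dot (z1 v)) e; rewrite !dot_step corner_det // !mulr1.
by move/addrI => [].
Qed.

Lemma edge_pointsP p : p \in edge_points ->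
  exists v z j l, [/\ v \in W, step v z l \in W, p = step v z j,
    (j <= l)%N /\ (0 < l)%N & z != 0 /\ minimized W z v].
Proof.
move=> /allpairsPdep[v [j [vW + ->]]]; rewrite mem_iota add0n /= => jl.
have [l0 wW _] := edge_lengthP vW; have [d1 _ m _] := cornerW vW.
exists v, (z2 v), j, (edge_length (z2 v)); split=> //; first by split; first exact: ltnW.
by split=> //; apply/eqP => e; move: d1; rewrite e /det /= !mulr0 subrr.
Qed.

End Polygon.

(** * Encoding by a tree and edge lengths *)

Fixpoint xsum (ls : seq nat) (s : seq ivec) : int :=
  match ls, s with
  | l :: ls', z :: s' => l%:Z * z.1 + xsum ls' s'
  | _, _ => 0
  end.

(** Pairing with [y] reads off first coordinates, so for a closed walk [xsum] vanishes. *)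
Lemma dot_last_walk x y v ls s : det x y = 1 ->
  dot y (last v (walk v ls (map (lin x y) s))) = dot y v - xsum ls s.
Proof.
move=> d1; elim: ls s v => [|l ls IH] [|z s] v /=; rewrite ?subr0 //.
by rewrite IH dot_step detE d1; ring.
Qed.

Lemma xsum_mono ls s s' : all (leq 1) ls -> (size s <= size ls)%N ->
  all2 (fun z z' : ivec => z.1 <= z'.1) s s' ->
  xsum ls s <= xsum ls s' ?= iff (map fst s == map fst s').
Proof.
elim: ls s s' => [|l ls IH] [|z s] [|z' s'] //= /andP[l0 ls0] sz /andP[le1 le2].
rewrite eqseq_cons; apply: leifD; last exact: IH.
apply/leifP; case: eqVneq le1 => [->//|ne le1].
by rewrite ltr_pM2l ?ltz_nat // lt_neqAle ne.
Qed.

Lemma all2_cat (T : Type) (r : rel T) (s1 s2 t1 t2 : seq T) :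
  size s1 = size t1 -> all2 r (s1 ++ s2) (t1 ++ t2) = all2 r s1 t1 && all2 r s2 t2.
Proof. by elim: s1 t1 => [|x s1 IH] [|y t1] //= [/IH->]; rewrite andbA. Qed.

Lemma rays_mono t (x y x' y' : ivec) : x.1 <= x'.1 -> y.1 <= y'.1 ->
  all2 (fun z z' : ivec => z.1 <= z'.1) (rays t x y) (rays t x' y').
Proof.
elim: t x y x' y' => [|t1 IH1 t2 IH2] x y x' y' hx hy /=; first by rewrite hy.
by rewrite all2_cat ?size_rays // IH1 ?IH2 //=; apply: lerD.
Qed.

Lemma all2_refl (T : Type) (r : rel T) s : (forall x, r x x) -> all2 r s s.
Proof. by move=> h; elim: s => //= x s ->; rewrite h. Qed.

(* The first coordinate of the closing condition is strictly increasing in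
   the Hirzebruch parameter [b]. *)
Lemma circuit_inj t ls b b' : size ls = size (circuit t (1, 0) (0, 1) b) ->
  all (leq 1) ls ->
  xsum ls (circuit t (1, 0) (0, 1) b) = 0 ->
  xsum ls (circuit t (1, 0) (0, 1) b') = 0 ->
  circuit t (1, 0) (0, 1) b = circuit t (1, 0) (0, 1) b'.
Proof.
wlog le : b b' / b <= b'.
  move=> h sz l0 e e'; have [|/ltW] := leP b b'; first by move/h; apply.
  by move/h => h'; rewrite h' // size_circuit -(size_circuit t (1, 0) (0, 1) b).
(* For [Leaf] the circuit does not contain the parameter, so the circuits are compared rather than
   [b] and [b']. *)
case: t => // t1 t2 sz l0 e e'.
set s := circuit _ _ _ b in sz e *; set s' := circuit _ _ _ b' in e' *.
have mono : all2 (fun z z' : ivec => z.1 <= z'.1) s s'.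
  rewrite /s /s' /= all2_cat // all2_refl //=.
  by rewrite /lin /= rays_mono //=; lia.
(* Both sums vanish, so this is the equality case: first coordinates agree, and those of the
   successors of [(-1, 0)] are [b] and [b']. *)
have [_] := xsum_mono l0 (eq_leq (esym sz)) mono.
rewrite e e' eqxx /s /s' /= !map_cat /= => /esym.
rewrite eqseq_cons eqxx /= eqseq_cat // eqxx /= eqseq_cons => /andP[/eqP eb _].
suff -> : b = b' by [].
by move: eb; rewrite /lin /=; lia.
Qed.

(* The affine map that sends [v] to [v'] and, for every [c], the edge direction
   with normal [lin x y c] to the one with normal [lin x' y' c]. *)
Definition transport (x y v x' y' v' p : ivec) : ivec :=
  let a := dot y p - dot y v in let b := dot x p - dot x v in
  (v'.1 - a * x'.2 + b * y'.2, v'.2 + a * x'.1 - b * y'.1).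

Lemma transport_base x y v x' y' v' : transport x y v x' y' v' v = v'.
Proof.
by case: v' => a b; rewrite /transport !subrr; congr pair; rewrite /=; ring.
Qed.

Lemma transport_step x y v x' y' v' p c l : det x y = 1 ->
  transport x y v x' y' v' (step p (lin x y c) l) =
  step (transport x y v x' y' v' p) (lin x' y' c) l.
Proof.
move=> d1; rewrite /transport !dot_step !detE d1 /step /lin /=.
by congr pair; ring.
Qed.

Lemma transportK x y v x' y' v' : det x y = 1 -> det x' y' = 1 ->
  cancel (transport x y v x' y' v') (transport x' y' v' x y v).
Proof.
move=> d1 d2 p; set q := transport _ _ _ _ _ _ p.
have ex : dot x' q - dot x' v' = dot x p - dot x v.
  rewrite /q /transport /dot /= -[RHS]mulr1 -d2 /det /dot; ring.
have ey : dot y' q - dot y' v' = dot y p - dot y v.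
  rewrite /q /transport /dot /= -[RHS]mulr1 -d2 /det /dot; ring.
rewrite /transport ex ey; apply: (dot_inj d1); rewrite /dot /=.
  transitivity (dot x v + (dot x p - dot x v) * det x y).
    by rewrite /dot /det; ring.
  by rewrite d1 /dot; ring.
transitivity (dot y v + (dot y p - dot y v) * det x y).
  by rewrite /dot /det; ring.
by rewrite d1 /dot; ring.
Qed.

Lemma transport_walk x y v x' y' v' p ls s : det x y = 1 ->
  map (transport x y v x' y' v') (walk p ls (map (lin x y) s)) =
  walk (transport x y v x' y' v' p) ls (map (lin x' y') s).
Proof.
move=> d1; elim: ls s p => [|l ls IH] [|z s] p //=.
by rewrite IH transport_step.
Qed.

(** * Codes and their number *)

Fixpoint bits t : seq bool :=
  if t is Node t1 t2 then true :: bits t1 ++ bits t2 else [:: false].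

(** Preorder notation is prefix free, so padding the word loses nothing. *)
Lemma bits_prefix_free t t' r r' : bits t ++ r = bits t' ++ r' -> t = t' /\ r = r'.
Proof.
elim: t t' r r' => [|t1 IH1 t2 IH2] [|t1' t2'] r r' //=; first by case.
by case; rewrite -!catA => /IH1[-> /IH2[-> ->]].
Qed.

Lemma size_bits t : (size (bits t)).+1 = (leaves t).*2.
Proof.
elim: t => //= t1 IH1 t2 IH2.
by rewrite size_cat doubleD -IH1 -IH2 addSn addnS.
Qed.

(** The word is padded with [false] to [2 k] bits. In use, [ms] holds edge lengths minus one with
    sum at most [n - k], so each entry fits the ordinal type. *)
Definition code (k n : nat) (t : tree) (ms : seq nat) :
    k.*2.-tuple bool * k.-tuple 'I_(n - k).+1 :=
  ([tuple nth false (bits t) i | i < k.*2], [tuple inord (nth 0%N ms i) | i < k]).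

Section CodeInj.
Variables k n : nat.

Lemma sumn_mem (ms : seq nat) m : m \in ms -> (m <= sumn ms)%N.
Proof.
elim: ms => //= a ms IH; rewrite inE => /predU1P[->|/IH h]; first exact: leq_addr.
exact: leq_trans h (leq_addl _ _).
Qed.

Lemma code_lengths t ms : size ms = k -> (sumn ms <= n - k)%N ->
  map val (code k n t ms).2 = ms.
Proof.
move=> sz sm; apply: (@eq_from_nth _ 0%N); rewrite size_map size_tuple ?sz // => i ik.
rewrite (nth_map (tnth (code k n t ms).2 (Ordinal ik))) ?size_tuple //.
rewrite -[i in LHS]/(val (Ordinal ik)) -tnth_nth tnth_mktuple /= inordK // ltnS.
by apply: leq_trans sm; apply: sumn_mem; rewrite mem_nth ?sz.
Qed.

Lemma code_bits t ms : (leaves t <= k)%N ->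
  val (code k n t ms).1 = bits t ++ nseq (k.*2 - size (bits t)) false.
Proof.
move=> tk; have szt : (size (bits t) <= k.*2)%N.
  by apply: leq_trans (leqnSn _) _; rewrite size_bits leq_double.
apply: (@eq_from_nth _ false).
  by rewrite size_tuple size_cat size_nseq subnKC.
rewrite size_tuple => i ik; rewrite -[i in LHS]/(val (Ordinal ik)) -tnth_nth.
rewrite tnth_mktuple nth_cat /=; case: ltnP => // le.
by rewrite nth_default // nth_nseq if_same.
Qed.

Lemma code_inj t ms t' ms' :
  (leaves t <= k)%N -> (leaves t' <= k)%N -> size ms = k -> size ms' = k ->
  (sumn ms <= n - k)%N -> (sumn ms' <= n - k)%N ->
  code k n t ms = code k n t' ms' -> t = t' /\ ms = ms'.
Proof.
move=> tk tk' sz sz' sm sm' e; split; last first.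
  by rewrite -(code_lengths t sz sm) e code_lengths.
have := code_bits ms tk; rewrite e code_bits //.
by move/esym/bits_prefix_free => [].
Qed.

Definition codes : {set k.*2.-tuple bool * k.-tuple 'I_(n - k).+1} :=
  finset.setX [set: k.*2.-tuple bool]%SET
    [set c : k.-tuple 'I_(n - k).+1 | (\sum_(i <- c) i <= n - k)%N]%SET.

Lemma mem_codes t ms : size ms = k -> (sumn ms <= n - k)%N ->
  code k n t ms \in codes.
Proof.
move=> sz sm; rewrite !inE /=.
by rewrite -(big_map val xpredT id) -sumnE code_lengths.
Qed.

(** Stars and bars count the [k] nonnegative integers with sum at most [n - k]; the [2 k] bits give
    [4 ^ k]. *)
Lemma card_codes : (k <= n)%N -> #|codes| = (4 ^ k * 'C(n, k))%N.
Proof.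
move=> kn; rewrite cardsX cardsT card_tuple card_bool card_partial_ord_partitions.
by rewrite subnKC // -muln2 (mulnC k) expnM.
Qed.

End CodeInj.

Local Open Scope classical_set_scope.

(** * Convex hulls *)

Section Hull.
Variable R : realType.
Implicit Types (S C : set 'rV[R]_2) (x y v : 'rV[R]_2).

Definition convex C := forall x y (t : R), C x -> C y -> 0 < t < 1 ->
  C ((1 - t) *: x + t *: y).

Lemma sub_hull S : S `<=` convex_hull S.
Proof.
move=> x Sx; exists 1%N, (fun=> x), (fun=> 1); split=> //.
  by rewrite big_ord_recl big_ord0 addr0.
by rewrite big_ord_recl big_ord0 addr0 scale1r.
Qed.

Lemma hull_convex S : convex (convex_hull S).
Proof.
move=> _ _ t [m [p [w [Sp w0 w1 ->]]]] [m' [p' [w' [Sp' w0' w1' ->]]]].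
move=> /andP[t0 t1].
exists (m + m')%N,
  (fun i => match fintype.split i with inl j => p j | inr j => p' j end),
  (fun i => match fintype.split i with inl j => (1 - t) * w j | inr j => t * w' j end).
have splitl (j : 'I_m) : fintype.split (lshift m' j) = inl j by exact: (unsplitK (inl j)).
have splitr (j : 'I_m') : fintype.split (rshift m j) = inr j by exact: (unsplitK (inr j)).
split.
- by move=> i; case: (fintype.split i).
- by move=> i; case: (fintype.split i) => j; rewrite mulr_ge0 // ?subr_ge0 ltW.
- rewrite big_split_ord /=.
  under eq_bigr do rewrite splitl; under [X in _ + X]eq_bigr do rewrite splitr.
  by rewrite -!mulr_sumr w1 w1' !mulr1 subrK.
- rewrite big_split_ord /=.
  under [in RHS]eq_bigr do rewrite splitl -scalerA.
  under [X in _ = _ + X]eq_bigr do rewrite splitr -scalerA.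
  by rewrite -!scaler_sumr.
Qed.

(** Split off one point and rescale the rest to total weight 1; vanishing weights are treated apart
    because [convex] speaks of [0 < t < 1]. *)
Lemma hull_min S C : convex C -> S `<=` C -> convex_hull S `<=` C.
Proof.
move=> cC SC _ [m [p [w [Sp w0 w1 ->]]]].
have {Sp}Cp i : C (p i) by exact: SC.
elim: m p w w0 w1 Cp => [|m IH] p w w0 w1 Cp.
  by move: w1; rewrite big_ord0 => /eqP; rewrite eq_sym oner_eq0.
rewrite big_ord_recl in w1; rewrite big_ord_recl.
have s0 : 0 <= \sum_(i < m) w (lift ord0 i) by apply: sumr_ge0 => i _.
have [e|ne] := eqVneq (\sum_(i < m) w (lift ord0 i)) 0.
  have wz i : w (lift ord0 i) = 0.
    move/eqP: e; rewrite psumr_eq0 // => /allP/(_ i).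
    by rewrite mem_index_enum => /(_ isT)/eqP.
  rewrite big1 ?addr0; last by move=> i _; rewrite wz scale0r.
  by move: w1; rewrite e addr0 => ->; rewrite scale1r.
set t := \sum_(i < m) _ in w1 s0 ne.
have t0 : 0 < t by rewrite lt_neqAle eq_sym ne.
have [w00|w00] := eqVneq (w ord0) 0.
  rewrite w00 scale0r add0r; apply: IH => //.
  by move: w1; rewrite w00 add0r.
have t1 : t < 1 by rewrite -w1 ltrDr lt_neqAle eq_sym w00 w0.
have -> : w ord0 *: p ord0 + \sum_(i < m) w (lift ord0 i) *: p (lift ord0 i) =
    (1 - t) *: p ord0 + t *: \sum_(i < m) (t^-1 * w (lift ord0 i)) *: p (lift ord0 i).
  rewrite -{1}w1 addrK scaler_sumr; congr (_ + _); apply: eq_bigr => i _.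
  by rewrite scalerA mulrA divff // mul1r.
apply: cC; rewrite ?t0 //; apply: IH => //.
  by move=> i; rewrite mulr_ge0 // invr_ge0 ltW.
by rewrite -mulr_sumr mulVf.
Qed.

Lemma hull_mono S S' : S `<=` S' -> convex_hull S `<=` convex_hull S'.
Proof.
by move=> h; apply: hull_min; [exact: hull_convex|move=> x /h; exact: sub_hull].
Qed.

Lemma hull_affine (f : 'rV[R]_2 -> 'rV[R]_2) (A : 'M[R]_2) b S :
  (forall x, f x = x *m A + b) -> f @` convex_hull S = convex_hull (f @` S).
Proof.
move=> fE; apply/seteqP; split.
  move=> _ [_ [m [p [w [Sp w0 w1 ->]]]] <-].
  exists m, (f \o p), w; split=> //; first by move=> i; exists (p i).
  rewrite fE mulmx_suml -[X in _ + X]scale1r -w1 scaler_suml -big_split /=.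
  by apply: eq_bigr => i _; rewrite fE scalerDr scalemxAl.
apply: hull_min; last by move=> _ [x Sx <-]; exists x => //; exact: sub_hull.
move=> _ _ t [x hx <-] [y hy <-] t01.
exists ((1 - t) *: x + t *: y); first exact: hull_convex.
rewrite !fE mulmxDl -!scalemxAl !scalerDr addrACA -scalerDl subrK scale1r.
by rewrite !scalerDl.
Qed.

(** If [v] were outside [S], deleting this extreme point would leave a convex set that still
    contains [S]. *)
Lemma vertices_hull_sub S : vertices (convex_hull S) `<=` S.
Proof.
move=> v [Pv ext]; apply: contrapT => Sv.
pose C := convex_hull S `\ v.
suff /(_ v Pv)[_ /(_ erefl)] : convex_hull S `<=` C by [].
apply: hull_min; last first.
  by move=> x Sx; split; [exact: sub_hull|move=> /= e; rewrite e in Sx].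
move=> x y t [Px nx] [Py ny] t01; split; first exact: hull_convex.
by move=> /= e; have [ex _] := ext x y t Px Py t01 (esym e).
Qed.

Lemma weighted_mean (a b : R) x y : a + b != 0 ->
  (a + b) *: ((1 - b / (a + b)) *: x + (b / (a + b)) *: y) = a *: x + b *: y.
Proof. by move=> ab; apply/rowP => i; rewrite !mxE; field. Qed.

Lemma vertex_of_notin_hull S v :
  S v -> ~ convex_hull (S `\ v) v -> vertices (convex_hull S) v.
Proof.
move=> Sv nv; split; first exact: sub_hull.
set H := convex_hull (S `\ v) in nv.
(* [C] is the cone with apex [v] over [H]. It contains the whole hull, and an open segment through
   [v] with ends off the apex would make [v] a convex combination of points of [H]. *)
pose C := [set x | x = v \/ exists (m : R) h, [/\ 0 < m, H h & x = v + m *: (h - v)]].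
have cC : convex C.
  move=> x y t + + /andP[t0 t1]; have t1' : 0 < 1 - t by rewrite subr_gt0.
  move=> [->|[m [h [m0 Hh ->]]]] [->|[m' [h' [m0' Hh' ->]]]].
  - by left; rewrite -scalerDl subrK scale1r.
  - right; exists (t * m'), h'; split=> //; first exact: mulr_gt0.
    by rewrite scalerDr addrA -scalerDl subrK scale1r scalerA.
  - right; exists ((1 - t) * m), h; split=> //; first exact: mulr_gt0.
    by rewrite scalerDr addrAC -scalerDl subrK scale1r scalerA.
  - right; set a := (1 - t) * m; set b := t * m'.
    have a0 : 0 < a by exact: mulr_gt0.
    have b0 : 0 < b by exact: mulr_gt0.
    have ab0 : 0 < a + b by exact: addr_gt0.
    exists (a + b), ((1 - b / (a + b)) *: h + (b / (a + b)) *: h'); split=> //.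
      by apply: hull_convex => //; rewrite divr_gt0 //= ltr_pdivrMr // mul1r ltrDr.
    rewrite [in RHS]scalerBr weighted_mean ?gt_eqF // /a /b.
    by apply/rowP => i; rewrite !mxE; ring.
have PC : convex_hull S `<=` C.
  apply: hull_min => // x Sx; have [->|xv] := eqVneq x v; [by left|right].
  exists 1, x; split=> //; last by rewrite scale1r addrC subrK.
  by apply: sub_hull; split=> //; apply/eqP.
move=> x y t /PC + /PC + /andP[t0 t1].
have t1' : 0 < 1 - t by rewrite subr_gt0.
have vt : v = (1 - t) *: v + t *: v by rewrite -scalerDl subrK scale1r.
move=> [->|Cx] [->|Cy].
- by [].
- move=> e; have {}e : t *: y = t *: v.
    by apply: (addrI ((1 - t) *: v)); rewrite -e -vt.
  by split=> //; exact: (scalerI (lt0r_neq0 t0)).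
- move=> e; have {}e : (1 - t) *: x = (1 - t) *: v.
    by apply: (addIr (t *: v)); rewrite -e -vt.
  by split=> //; exact: (scalerI (lt0r_neq0 t1')).
move: Cx Cy => [m [h [m0 Hh ->]]] [m' [h' [m0' Hh' ->]]].
set a := (1 - t) * m; set b := t * m'.
have a0 : 0 < a by exact: mulr_gt0.
have b0 : 0 < b by exact: mulr_gt0.
have ab0 : 0 < a + b by exact: addr_gt0.
move=> e; case: nv.
have := @hull_convex (S `\ v) h h' (b / (a + b)) Hh Hh'.
rewrite divr_gt0 //= ltr_pdivrMr // mul1r ltrDr a0 => /(_ isT).
suff -> : (1 - b / (a + b)) *: h + (b / (a + b)) *: h' = v by [].
apply: (scalerI (lt0r_neq0 ab0)).
rewrite weighted_mean ?gt_eqF //; apply/rowP => i.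
by move/rowP: e => /(_ i); rewrite /a /b !mxE; lra.
Qed.

(** Discard points that lie in the hull of the others until there are none; the rest are then
    exactly the vertices. *)
Lemma polytope_vertices (s : seq 'rV[R]_2) :
  exists2 s', {subset s' <= s} & uniq s' /\
    let P := convex_hull [set` s] in P = convex_hull [set` s'] /\ vertices P = [set` s'].
Proof.
have [m] := ubnP (size s); elim: m s => // m IH s ltm.
have setrem (r : seq 'rV[R]_2) v : uniq r -> [set` rem v r] = [set` r] `\ v.
  move=> ur; apply/seteqP; split=> x /=; rewrite mem_rem_uniq // !inE.
    by move=> /andP[/eqP].
  by move=> [xr /eqP xv]; rewrite xv.
have sz := size_undup s.
have es : [set` undup s] = [set` s].
  by apply/seteqP; split=> x /=; rewrite mem_undup.
have us := undup_uniq s.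
have [[v vs hv]|none] := pselect (exists2 v, v \in undup s &
    convex_hull ([set` undup s] `\ v) v).
  have [|s' sub [us' [e1 e2]]] := IH (rem v (undup s)).
    have s0 : (0 < size (undup s))%N by case: (undup s) vs.
    by rewrite size_rem // prednK // (leq_trans sz).
  exists s'; first by move=> x /sub /mem_rem; rewrite mem_undup.
  have eP : convex_hull [set` s] = convex_hull [set` rem v (undup s)].
    rewrite setrem // -es; apply/seteqP; split; last by apply: hull_mono => x [].
    apply: hull_min; first exact: hull_convex.
    move=> x sx; have [->//|xv] := eqVneq x v.
    by apply: sub_hull; split=> //; apply/eqP.
  by rewrite /= eP.
exists (undup s); first by move=> x; rewrite mem_undup.
split=> //=; rewrite -es; split=> //; apply/seteqP; split.
  exact: vertices_hull_sub.
move=> v vs; apply: vertex_of_notin_hull => // hv; apply: none.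
by exists v.
Qed.

End Hull.

(** * Smooth polygons and their codes *)

Section Points.
Variable R : realType.
Implicit Types (P : set 'rV[R]_2) (W : seq ivec).

Definition ivec_of (z : 'rV[int]_2) : ivec := (z 0 0, z 0 1).

Definition pt (p : ivec) : 'rV[R]_2 :=
  of_lattice R (\row_j if j == 0 then p.1 else p.2).

Lemma pt0 p : pt p 0 0 = p.1%:~R. Proof. by rewrite !mxE. Qed.

Lemma pt1 p : pt p 0 1 = p.2%:~R. Proof. by rewrite !mxE. Qed.

Lemma row2P (T : Type) (x y : 'rV[T]_2) : x 0 0 = y 0 0 -> x 0 1 = y 0 1 -> x = y.
Proof.
move=> e0 e1; apply/rowP => -[[|[|i]] hi] //.
  by rewrite (_ : Ordinal hi = 0) //; apply: val_inj.
by rewrite (_ : Ordinal hi = 1) //; apply: val_inj.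
Qed.

Lemma pt_ivec_of z : pt (ivec_of z) = of_lattice R z.
Proof. by apply: row2P; rewrite !mxE. Qed.

Lemma pt_inj : injective pt.
Proof.
move=> [a b] [c d] e; have := congr1 (fun x : 'rV_2 => x 0 0) e.
have := congr1 (fun x : 'rV_2 => x 0 1) e; rewrite /= !pt0 !pt1 /=.
by move=> /intr_inj-> /intr_inj->.
Qed.

Lemma lattice_pt p : lattice (pt p).
Proof. by eexists. Qed.

Lemma latticeP x : lattice x -> exists p, x = pt p.
Proof. by move=> [z _ <-]; exists (ivec_of z); rewrite pt_ivec_of. Qed.

Lemma pairingE (u x : 'rV[R]_2) : pairing u x = u 0 0 * x 0 0 + u 0 1 * x 0 1.
Proof.
rewrite /pairing mxE !big_ord_recl big_ord0 addr0 !mxE.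
by rewrite (_ : lift ord0 ord0 = 1) //; apply: val_inj.
Qed.

Lemma pairing_pt u x : pairing (pt u) (pt x) = (dot u x)%:~R.
Proof. by rewrite pairingE !pt0 !pt1 /dot rmorphD !rmorphM. Qed.

Lemma det_col_mx2 (z1 z2 : 'rV[int]_2) :
  \det (col_mx z1 z2 : 'M[int]_2) = det (ivec_of z1) (ivec_of z2).
Proof.
have e1 : lift ord0 ord0 = 1 :> 'I_2 by apply: val_inj.
have e2 : lift 1 0 = 0 :> 'I_2 by apply: val_inj.
rewrite (expand_det_row _ 0) !big_ord_recl big_ord0 addr0 /cofactor !det_mx11.
have top j : (col_mx z1 z2 : 'M[int]_2) 0 j = z1 0 j.
  by rewrite -[RHS](col_mxEu z1 z2) (_ : lshift 1 0 = 0) //; apply: val_inj.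
have bot j : (col_mx z1 z2 : 'M[int]_2) 1 j = z2 0 j.
  by rewrite -[RHS](col_mxEd z1 z2) (_ : rshift 1 0 = 1) //; apply: val_inj.
have minor (A : 'M[int]_2) i j : row' i (col' j A) 0 0 = A (lift i 0) (lift j 0).
  by rewrite !mxE.
rewrite !minor !e1 e2 !top !bot /= /det /=.
by rewrite expr0 expr1 mul1r mulN1r mulrN.
Qed.

(** The real coefficients of an integer normal [u] in the cone are [det u y] and [det x u], which
    brings nonnegativity back to the integers. *)
Lemma cone_corner P W v x y : P = convex_hull [set` map pt W] ->
  det x y = 1 -> normal_cone P (pt v) = cone (pt x) (pt y) -> corner W v x y.
Proof.
move=> PE d1 nE.
have PW w : w \in W -> P (pt w).
  by move=> wW; rewrite PE; apply: sub_hull; rewrite /= map_f.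
have minz z : normal_cone P (pt v) (pt z) -> minimized W z v.
  by move=> h w /PW /h; rewrite !pairing_pt ler_int.
split=> //.
- by apply: minz; rewrite nE; exists 1, 0; rewrite scale1r scale0r addr0.
- by apply: minz; rewrite nE; exists 0, 1; rewrite scale1r scale0r add0r.
move=> u mu; have : normal_cone P (pt v) (pt u).
  rewrite PE; apply: hull_min; last first.
    by move=> _ /mapP[w wW ->] /=; rewrite !pairing_pt ler_int mu.
  move=> p q t; rewrite /= !pairingE !mxE.
  by move: (v.1%:~R) (v.2%:~R) (u.1%:~R) (u.2%:~R) (p 0 0) (p 0 1) (q 0 0) (q 0 1)
    => a b c d p0 p1 q0 q1 h1 h2 /andP[t0 t1]; nra.
rewrite nE => -[a [b [a0 b0 e]]].
have := congr1 (fun x : 'rV_2 => x 0 0) e; have := congr1 (fun x : 'rV_2 => x 0 1) e.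
rewrite /= !mxE /= => e1 e0.
have dR : (det x y)%:~R = 1 :> R by rewrite d1.
rewrite -!(ler0z R).
have -> : (det u y)%:~R = a * (det x y)%:~R :> R.
  by rewrite /det !rmorphB !rmorphM /= e0 e1; ring.
have -> : (det x u)%:~R = b * (det x y)%:~R :> R.
  by rewrite /det !rmorphB !rmorphM /= e0 e1; ring.
by rewrite dR !mulr1.
Qed.

Lemma coneC (u1 u2 : 'rV[R]_2) : cone u1 u2 = cone u2 u1.
Proof.
by apply/seteqP; split=> x [a [b [a0 b0 ->]]]; exists b, a; rewrite addrC.
Qed.

(** A basis of determinant -1 becomes positively oriented by swapping its members. *)
Lemma smooth_corner P W : P = convex_hull [set` map pt W] ->
  vertices P = [set` map pt W] -> smooth P ->
  forall v, v \in W -> exists x y, corner W v x y.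
Proof.
move=> PE vE sm v vW; have [|z1 [z2 [_ _ nE basis]]] := sm (pt v).
  by rewrite vE /= map_f.
rewrite -!pt_ivec_of in nE.
have /orP[/eqP d1|/eqP d1] : (det (ivec_of z1) (ivec_of z2) == 1) ||
    (det (ivec_of z1) (ivec_of z2) == -1).
  by move: basis; rewrite /lattice_basis unitmxE det_col_mx2.
- by exists (ivec_of z1), (ivec_of z2); apply: cone_corner PE d1 nE.
exists (ivec_of z2), (ivec_of z1); apply: cone_corner PE _ _.
  by rewrite detC d1 opprK.
by rewrite coneC.
Qed.

(** If [p] were interior, [p - e z] would be in [P] for some [e > 0], and pairing with [z] would
    drop below its minimum. *)
Lemma boundary_supported P p (z : ivec) : z != 0 -> P p ->
  (forall x, P x -> pairing (pt z) p <= pairing (pt z) x) -> boundary P p.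
Proof.
move=> z0 Pp hz; split; first exact: subset_closure.
move=> nP.
have cv : (fun e : R => p - e *: pt z) @ (0 : R)^'+ --> p - 0 *: pt z.
  apply: cvgB; first exact: cvg_cst.
  by apply: cvgZr_tmp; apply: cvg_at_right_filter; exact: cvg_id.
rewrite scale0r subr0 in cv.
have [e [/= e0 /hz]] := filter_ex (filterI (nbhs_right_gt 0) (cv _ nP)).
rewrite !pairingE !mxE /= => h.
have h2 : e * ((z.1 ^+ 2 + z.2 ^+ 2)%:~R : R) <= 0.
  by rewrite rmorphD !rmorphXn /=; lra.
move: h2; rewrite pmulr_rle0 // lerz0 => h2; move/negP: z0; apply.
apply/eqP; case: (z) h2 => a b /= h2; congr pair; nia.
Qed.

End Points.

(** * Integral equivalence and the count *)

Section Equivalence.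
Variable R : realType.
Implicit Types (P Q : set 'rV[R]_2).

Lemma integrally_equivalent_trans P Q T : integrally_equivalent P Q ->
  integrally_equivalent Q T -> integrally_equivalent P T.
Proof.
move=> [A [b [bij1 e1]]] [A' [b' [bij2 e2]]].
exists (A *m A'), (b *m A' + b'); set f := fun x => _.
have fE : f = (fun x => x *m A' + b') \o (fun x => x *m A + b).
  by apply/funext => x; rewrite /f /= mulmxDl mulmxA addrA.
rewrite /= fE; split; first exact: set_bij_comp bij1 bij2.
by rewrite -image_comp e1 e2.
Qed.

Lemma transport_affine x y v x' y' v' : exists (A : 'M[R]_2) (b : 'rV[R]_2),
  forall p, pt R (transport x y v x' y' v' p) = pt R p *m A + b.
Proof.
(* [a0] and [a1] are the images of the unit vectors under the linear part of [transport]; [b] is the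
   image of the origin. *)
pose a0 : ivec := (x.1 * y'.2 - y.1 * x'.2, y.1 * x'.1 - x.1 * y'.1).
pose a1 : ivec := (x.2 * y'.2 - y.2 * x'.2, y.2 * x'.1 - x.2 * y'.1).
pose b : ivec := (v'.1 + dot y v * x'.2 - dot x v * y'.2,
                  v'.2 - dot y v * x'.1 + dot x v * y'.1).
exists (\matrix_(i, j) if i == 0 then pt R a0 0 j else pt R a1 0 j), (pt R b).
have e1 : lift ord0 ord0 = 1 :> 'I_2 by apply: val_inj.
move=> p; apply: row2P; rewrite !mxE !big_ord_recl big_ord0 !e1 !mxE /= addr0.
  by rewrite -!rmorphM -!rmorphD /=; congr intr; rewrite /dot; ring.
by rewrite -!rmorphM -!rmorphD /=; congr intr; rewrite /dot; ring.
Qed.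

(* Walking around the circuit from [v] with edge lengths [m + 1], [m] in [ms],
   visits the vertices of [P]. *)
Definition coded P (t : tree) (ms : seq nat) :=
  exists x y b v,
    let s := circuit t x y b in let ws := walk v (map succn ms) s in
    [/\ det x y = 1, size ms = (leaves t + 2)%N, last v ws = v &
        P = convex_hull [set` map (pt R) ws]].

Lemma image_seq (T U : eqType) (f : T -> U) (s : seq T) :
  f @` [set` s] = [set` map f s].
Proof.
apply/seteqP; split=> [_ [x xs <-]|_ /mapP[x xs ->]]; first exact: map_f.
by exists x.
Qed.

(** Closing up determines the standard circuit, so [transport] carries one walk to the other; its
    inverse is again integral. *)
Lemma coded_equivalent P P' t ms :
  coded P t ms -> coded P' t ms -> integrally_equivalent P P'.
Proof.
move=> [x [y [b [v [d1 sz cl ->]]]]] [x' [y' [b' [v' [d1' _ cl' ->]]]]].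
have szc : size (map succn ms) = size (circuit t (1, 0) (0, 1) b).
  by rewrite size_map sz size_circuit.
have pos : all (leq 1) (map succn ms) by rewrite all_map; apply/allP.
have xs0 : xsum (map succn ms) (circuit t (1, 0) (0, 1) b) = 0.
  have := dot_last_walk v (map succn ms) (circuit t (1, 0) (0, 1) b) d1.
  by rewrite -circuit_lin cl => /esym/eqP; rewrite subr_eq addrC -subr_eq subrr => /eqP.
have xs0' : xsum (map succn ms) (circuit t (1, 0) (0, 1) b') = 0.
  have := dot_last_walk v' (map succn ms) (circuit t (1, 0) (0, 1) b') d1'.
  by rewrite -circuit_lin cl' => /esym/eqP; rewrite subr_eq addrC -subr_eq subrr => /eqP.
have ec := circuit_inj szc pos xs0 xs0'.
have [A [c fE]] := transport_affine x y v x' y' v'.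
exists A, c => f; split; last first.
  rewrite (@hull_affine _ f A c) // image_seq -map_comp (circuit_lin _ x y).
  rewrite (circuit_lin _ x' y') -ec -[in RHS](transport_base x y v x' y' v').
  rewrite -transport_walk // -map_comp.
  by rewrite (@eq_map _ _ (f \o pt R) (pt R \o transport x y v x' y' v')) // => p /=.
split.
- by move=> _ /latticeP[p ->]; rewrite /f -fE; exact: lattice_pt.
- move=> _ _ /set_mem/latticeP[p ->] /set_mem/latticeP[q ->].
  rewrite /f -!fE => /pt_inj e; congr pt.
  by rewrite -(transportK v v' d1 d1' p) e transportK.
- move=> _ /latticeP[p ->]; exists (pt R (transport x' y' v' x y v p)).
    exact: lattice_pt.
  by rewrite /f -fE transportK.
Qed.

Lemma card_seq (T : choiceType) (s : seq T) : uniq s -> ([set` s] #= `I_(size s))%card.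
Proof.
case: s => [_|x0 s us].
  by rewrite (_ : [set` [::]] = set0) ?II0 ?card_eq00 //; apply/seteqP; split.
have -> : [set` x0 :: s] = nth x0 (x0 :: s) @` `I_(size (x0 :: s)).
  apply/seteqP; split=> [y ys|_ [i il <-]]; last exact: mem_nth.
  by exists (index y (x0 :: s)); [rewrite /mkset index_mem | rewrite nth_index].
apply: inj_card_eq => i j /set_mem il /set_mem jl e.
by apply/eqP; rewrite -(nth_uniq x0 il jl us) e.
Qed.

Lemma seq_pt (s : seq 'rV[R]_2) : [set` s] `<=` lattice (R:=R) ->
  exists W, s = map (pt R) W.
Proof.
elim: s => [_|x s IH sub]; first by exists [::].
have [W ->] := IH (fun y ys => sub y (mem_behead (s := x :: s) ys)).
by have [p ->] := latticeP (sub x (mem_head x s)); exists (p :: W).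
Qed.

Lemma sumn_succ ms : sumn (map succn ms) = (sumn ms + size ms)%N.
Proof. by elim: ms => //= m ms ->; rewrite addSn addnS addnA. Qed.

Lemma smooth_gon_coded k n P : (k <= n)%N -> smooth_gons R k n P ->
  exists t ms, [/\ coded P t ms, (leaves t + 2)%N = k & (sumn ms <= n - k)%N].
Proof.
move=> kn [[[a [_ [_ [Pa _ _ _]]]] [S [/finite_seqP[s0 ->] subL PE0]]] sm cardv cardb].
have [s sub [us /=]] := polytope_vertices s0; rewrite -PE0 => -[PE vE].
have [W es] : exists W, s = map (pt R) W.
  by apply: seq_pt => x /sub /subL.
rewrite {}es in sub us PE vE.
have uW : uniq W by exact: map_uniq us.
have W0 : W != [::].
  apply/eqP => W0; move: Pa; rewrite PE W0 /=.
  have h : convex_hull [set` [::]] `<=` (set0 : set 'rV[R]_2) by apply: hull_min.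
  by move=> /h.
have PW w : w \in W -> P (pt R w).
  by move=> wW; rewrite PE; apply: sub_hull; rewrite /= map_f.
have szW : size W = k.
  apply/card_eq_II; rewrite -(size_map (pt R)).
  by rewrite -(card_eql (card_seq us)) -vE.
have /choice[z1 /choice[z2 hz]] : forall v, exists x, exists y, v \in W -> corner W v x y.
  move=> v; have [vW|vW] := boolP (v \in W).
    by have [x [y h]] := smooth_corner PE vE sm vW; exists x, y.
  by exists 0, 0.
have [t [x [y [b [v [ls [d1 els pern perw cl]]]]]]] := polygon_walk uW W0 hz.
set c := circuit t x y b in els pern perw cl.
have perz : perm_eq c (map z2 W).
  apply: perm_trans pern _; rewrite perm_sym; apply: uniq_perm.
  - by rewrite map_inj_in_uniq; [exact: uW | exact: (z2_inj hz)].
  - exact: uniq_normals hz.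
  - exact: normals_z2 uW hz.
have pos : all (leq 1) ls.
  apply/allP => l; rewrite els => /mapP[z]; rewrite (perm_mem perz) => /mapP[w wW ->] ->.
  by have [] := edge_lengthP hz wW.
(* Lengths are positive, so storing predecessors loses nothing and lowers the sum by [k]. *)
have els' : ls = map succn (map predn ls).
  rewrite -map_comp -[LHS]map_id; apply/eq_in_map => l /(allP pos) /= l0.
  by rewrite prednK.
have szc : size c = k by rewrite (perm_size pern) size_map.
have szls : size ls = k by rewrite els size_map.
exists t, (map predn ls); split.
- exists x, y, b, v; rewrite /= -els'; split=> //.
    by rewrite size_map szls -szc size_circuit.
  rewrite PE; congr convex_hull; apply/seteqP.
  by split=> u /=; rewrite (perm_mem (perm_map _ perw)).
- by rewrite -szc size_circuit.
(* The points of the half-open edges are distinct lattice points of the boundary, and there are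
   [sumn ls] of them. *)
have sumls : (sumn ls <= n)%N.
  have -> : sumn ls = size (edge_points W z1 z2).
    by rewrite size_edge_points els; apply: perm_sumn; apply: perm_map.
  rewrite -(size_map (pt R)) -card_le_II.
  have ub : uniq (map (pt R) (edge_points W z1 z2)).
    by rewrite map_inj_uniq; [exact: uniq_edge_points|exact: pt_inj].
  rewrite -(card_le_eql (card_seq ub)) -(card_le_eqr cardb).
  apply: subset_card_le => _ /mapP[p pB ->]; split; last exact: lattice_pt.
  have [u [z [j [l [uW' wW ep [jl l0] [z0 mz]]]]]] := edge_pointsP hz pB.
  apply: (boundary_supported z0); last first.
    rewrite {1}PE; apply: hull_min => [q r e|_ /mapP[w wW' ->]] /=.
      rewrite !pairingE !mxE => h1 h2 /andP[e0 e1]; nra.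
    by rewrite !pairing_pt ler_int ep dot_step detxx mulr0 addr0 mz.
  rewrite {}ep; have [->|j0] := posnP j; first by rewrite step0; exact: PW.
  have [->|jl'] := eqVneq j l; first exact: PW.
  have l0R : (l%:R : R) != 0 by rewrite pnatr_eq0 -lt0n.
  rewrite (_ : pt R _ = (1 - j%:R / l%:R) *: pt R u + (j%:R / l%:R) *: pt R (step u z l)).
    rewrite PE; apply: hull_convex; rewrite -?PE; try exact: PW.
    rewrite divr_gt0 ?ltr0n //= ltr_pdivrMr ?ltr0n // mul1r ltr_nat.
    by rewrite ltn_neqAle jl' jl.
  by apply: row2P; rewrite !mxE /= !(rmorphD, rmorphN, rmorphM) /= -!pmulrn; field.
by rewrite leq_subRL // -szls addnC -(size_map predn ls) -sumn_succ -els'.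
Qed.

Theorem smooth_gon_classes_bound k n : (k <= n)%N ->
  exists N, (smooth_gon_classes R k n #= `I_N)%card /\ (N <= 4 ^ k * 'C(n, k))%N.
Proof.
move=> kn; pose K := smooth_gon_classes R k n.
pose codes_class c (C : set (set 'rV[R]_2)) := K C /\ exists P t ms,
  [/\ C = [set Q | integrally_equivalent P Q], coded P t ms,
      (leaves t + 2)%N = k, (sumn ms <= n - k)%N & c = code k n t ms].
(* [set0] is the value at codes of no polygon. Elsewhere [uniq_class] makes the choice unique, so
   the codes cover all classes. *)
pose class c := xget set0 (codes_class c).
have coded_size P t ms : coded P t ms -> (leaves t + 2)%N = k -> size ms = k.
  by move=> [x [y [b [v [_ -> _ _]]]]].
have uniq_class c C C' : codes_class c C -> codes_class c C' -> C = C'.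
  move=> [_ [P [t [ms [-> cP tk sm ->]]]]] [_ [P' [t' [ms' [-> cP' tk' sm']]]]].
  have lek (t0 : tree) : (leaves t0 + 2)%N = k -> (leaves t0 <= k)%N.
    by move=> <-; exact: leq_addr.
  move=> /(code_inj (lek _ tk) (lek _ tk') (coded_size _ _ _ cP tk)
    (coded_size _ _ _ cP' tk') sm sm')[et ems].
  rewrite -{}et -{}ems in cP'; apply/seteqP; split=> Q /=.
    exact: integrally_equivalent_trans (coded_equivalent cP' cP).
  exact: integrally_equivalent_trans (coded_equivalent cP cP').
have KD : K `<=` class @` [set` enum (codes k n)].
  move=> C KC; have [P gP eC] := KC.
  have [t [ms [cP tk sm]]] := smooth_gon_coded kn gP.
  exists (code k n t ms).
    by rewrite /= mem_enum; apply: mem_codes => //; apply: coded_size cP tk.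
  have cC : codes_class (code k n t ms) C by split=> //; exists P, t, ms.
  by apply: (uniq_class (code k n t ms)) => //; apply: (xgetPex set0); exists C.
have cardK : (K #<= `I_#|codes k n|)%card.
  apply: card_le_trans (subset_card_le KD) _.
  apply: card_le_trans (card_image_le _ _) _.
  by rewrite cardE (card_le_eql (card_seq (enum_uniq _))).
have /card_le_finite/(_ (finite_II _))[N KN] := cardK.
exists N; split=> //; rewrite -card_codes //.
by rewrite -card_le_II -(card_le_eql KN).
Qed.

End Equivalence.

Theorem theorem25 (R : realType) (k n : nat) :
  (0 < k)%N -> (k <= n)%N ->
  exists N : nat,
    (smooth_gon_classes R k n #= `I_N)%card /\
    (N%:R <= 4 ^+ k * 'C(n, k)%:R * (n%:R / k%:R) :> R).
Proof.
move=> k0 kn; have [N [KN le]] := smooth_gon_classes_bound R kn.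
exists N; split=> //; apply: (@le_trans _ _ (4 ^+ k * 'C(n, k)%:R)).
  by rewrite -natrX -natrM ler_nat.
rewrite ler_peMr ?mulr_ge0 ?exprn_ge0 ?ler0n //.
by rewrite ler_pdivlMr ?ltr0n // mul1r ler_nat.
Qed.
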